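(* Let $K$ be a number field, let $\Phi:\mathbb{P}^1\to\mathbb{P}^1$ be a morphism of degree $\geq 2$ defined over $K$, and let $v$ be a finite place of $K$. Let $\Phi_v$ be the reduction of $\Phi$ modulo $v$, and suppose that $\Phi_v$ is separable. Then the following are equivalent: (a) $\Phi$ has critically good reduction (C.G.R.) at $v$; (b) $\Phi$ has simple good reduction (S.G.R.) at $v$ and $\#\Phi(\mathcal{R}_\Phi)=\#(\Phi(\mathcal{R}_\Phi))_v$.
   Context: $\mathbb{P}^1=\mathbb{P}^1(\overline{\mathbb{Q}})$, where $\overline{\mathbb Q}$ is the algebraic closure of $\mathbb Q$ (containing $K$). For a finite place $v$ of $K$, $O_v$ is the valuation ring and $k(v)$ the residue field; the place is identified with its valuation. Suppose $v$ has been extended to $\overline{\mathbb{Q}}$; for $E\subset\mathbb{P}^1(\overline{\mathbb{Q}})$, $(E)_v\subset\mathbb{P}^1(\overline{k(v)})$ denotes the set of reductions modulo $v$ of the elements of $E$. $\mathcal{R}_\Phi\subset\mathbb{P}^1(\overline{\mathbb{Q}})$ is the set of ramification points of $\Phi$ (points with ramification index $>1$). C.G.R.: $\Phi$ (of degree $\geq 2$, defined over $K$) has critically good reduction at $v$ if $\#\mathcal{R}_\Phi=\#(\mathcal{R}_\Phi)_v$ and $\#\Phi(\mathcal{R}_\Phi)=\#(\Phi(\mathcal{R}_\Phi))_v$ (this does not depend on the chosen extension of $v$). Reduction: write $\Phi([X:Y])=[F(X,Y):G(X,Y)]$ with $F,G\in O_v[X,Y]$ homogeneous of the same degree, coprime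 in $K[X,Y]$, with at least one coefficient of $F$ or $G$ a $v$-unit ($v$-reduced form). Then $\Phi_v=[F_v:G_v]$, where $F_v,G_v$ are obtained by reducing coefficients modulo $v$; it is regarded as a map $\mathbb{P}^1_{k(v)}\to\mathbb{P}^1_{k(v)}$ after cancelling common factors of $F_v,G_v$. S.G.R.: $\Phi$ has simple good reduction at $v$ if $\deg\Phi=\deg\Phi_v$ (equivalently, $F_v$ and $G_v$ have no common factor). $\Phi_v$ is separable if and only if it is not a $p$-th power as a rational function over $k(v)$, where $p$ is the characteristic of $k(v)$ (in particular a constant map is not separable). *)

(* Defs.v *)
From HB Require Import structures.
From mathcomp Require Import all_boot all_order all_algebra all_field.
From mathcomp Require Import generic_quotient ring_quotient.
From mathcomp Require Import boolp classical_sets functions cardinality.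
From mathcomp Require Import mpoly.

Set Implicit Arguments.
Unset Strict Implicit.
Unset Printing Implicit Defensive.

Import Order.TTheory GRing.Theory Num.Theory.
Local Open Scope ring_scope.
Local Open Scope quotient_scope.
Local Open Scope card_scope.

(* Values in rat are enough for the places of a number field K and for their
   extensions to the algebraic closure of K, whose value group is divisible of
   rank one. The value at 0 (mathematically +oo) is irrelevant. *)
Record valuation (L : fieldType) := Valuation {
  valuation_fun :> L -> rat;
  valuationM : forall x y, x != 0 -> y != 0 ->
    valuation_fun (x * y) = valuation_fun x + valuation_fun y;
  valuationD : forall x y, x != 0 -> y != 0 -> x + y != 0 ->
    Num.min (valuation_fun x) (valuation_fun y) <= valuation_fun (x + y)
}.

(* Normalised discrete valuations: the value group is exactly Z. *)
Definition finite_place (K : fieldExtType rat) (v : valuation K) : Prop :=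
  (forall x, x != 0 -> v x \is a Num.int) /\ (exists2 x, x != 0 & v x = 1).

Definition extends_valuation (K L : fieldType) (iota : {rmorphism K -> L})
    (v : valuation K) (w : valuation L) : Prop :=
  forall x, x != 0 -> w (iota x) = v x.

Section ValuationRing.
Variables (L : fieldType) (v : valuation L).

Definition val_integral : pred L := fun x => (x == 0) || (0 <= v x).

Lemma valuation1 : v 1 = 0.
Proof.
have /eqP := valuationM v (oner_neq0 L) (oner_neq0 L).
by rewrite mulr1 -subr_eq0 opprD addNKr oppr_eq0 => /eqP.
Qed.

Lemma valuationN1 : v (-1) = 0.
Proof.
have N1 : (-1 : L) != 0 by rewrite oppr_eq0 oner_neq0.
have /eqP := valuationM v N1 N1.
by rewrite mulrNN mulr1 valuation1 -mulr2n eq_sym mulrn_eq0 => /eqP.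
Qed.

Lemma valuationN x : x != 0 -> v (- x) = v x.
Proof.
move=> x0; rewrite -mulN1r valuationM ?valuationN1 ?add0r //.
by rewrite oppr_eq0 oner_neq0.
Qed.

Lemma valuationV x : x != 0 -> v x^-1 = - v x.
Proof.
move=> x0; apply/eqP; rewrite -addr_eq0 -valuationM ?invr_eq0 //.
by rewrite mulVf // valuation1.
Qed.

Fact val_integral_subring : subring_closed val_integral.
Proof.
split=> [|x y|x y]; rewrite /val_integral !unfold_in.
- by rewrite valuation1 lexx orbT.
- have [->|x0] /= := eqVneq x 0.
    by rewrite sub0r oppr_eq0; case: eqVneq => //= y0 _; rewrite valuationN.
  move=> vx; have [->|y0] /= := eqVneq y 0; first by rewrite subr0 vx orbT.
  move=> vy; case: eqVneq => //= xy.
  apply: le_trans (valuationD v x0 _ xy); rewrite ?oppr_eq0 //.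
  by rewrite valuationN // le_min vx.
- have [->|x0] /= := eqVneq x 0; first by rewrite mul0r eqxx.
  move=> vx; have [->|y0] /= := eqVneq y 0; first by rewrite mulr0 eqxx.
  by move=> vy; rewrite valuationM // addr_ge0 ?orbT.
Qed.
HB.instance Definition _ :=
  GRing.isSubringClosed.Build L val_integral val_integral_subring.

Record valring := ValRing { valring_val :> L; _ : valring_val \in val_integral }.
HB.instance Definition _ := [isSub for valring_val].
HB.instance Definition _ := [Choice of valring by <:].
HB.instance Definition _ := [SubChoice_isSubComNzRing of valring by <:].

Definition v_unit : pred valring := fun x => (val x != 0) && (v (val x) == 0).

Definition val_maximal : pred valring :=
  fun x => (val x == 0) || (0 < v (val x)).

Lemma v_unitE x : v_unit x = (x \notin val_maximal).
Proof.
rewrite /v_unit !unfold_in negb_or; case: eqVneq => //= x0.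
have := valP x; rewrite unfold_in (negPf x0) /= -leNgt => vx.
by rewrite eq_le vx andbT.
Qed.

Fact val_maximal_idealr : idealr_closed val_maximal.
Proof.
split=> [||a x y]; rewrite !unfold_in ?eqxx //.
  by rewrite oner_eq0 valuation1 ltxx.
have -> : val (a * x + y) = val a * val x + val y by [].
have [->|x0 /=] := eqVneq (val x) 0; first by rewrite mulr0 add0r.
move=> vx.
have [a0|a0] := eqVneq (val a) 0; first by rewrite a0 mul0r add0r.
have va : 0 <= v (val a).
  by have := valP a; rewrite unfold_in (negPf a0).
have ax0 : val a * val x != 0 by rewrite mulf_neq0.
have vax : 0 < v (val a * val x) by rewrite valuationM // ltr_wpDl.
have [->|y0 /=] := eqVneq (val y) 0; first by rewrite addr0 vax orbT.
move=> vy; case: eqVneq => //= axy.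
by apply: lt_le_trans (valuationD v ax0 y0 axy); rewrite lt_min vax.
Qed.
HB.instance Definition _ :=
  isIdealr.Build valring val_maximal val_maximal_idealr.

Definition val_maximal_ideal : idealr valring :=
  Idealr.clone valring val_maximal _.

Definition residue : Type := {ideal_quot val_maximal_ideal}.
HB.instance Definition _ := GRing.ComNzRing.on residue.

Definition red (x : valring) : residue := \pi_{ideal_quot val_maximal_ideal} x.

Fact red_zmod_morphism : zmod_morphism red.
Proof. exact: rmorphB. Qed.
Fact red_monoid_morphism : monoid_morphism red.
Proof. by split; [exact: rmorph1 | exact: rmorphM]. Qed.
HB.instance Definition _ :=
  GRing.isZmodMorphism.Build valring residue red red_zmod_morphism.
HB.instance Definition _ :=
  GRing.isMonoidMorphism.Build valring residue red red_monoid_morphism.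

Definition residue_inv (q : residue) : residue :=
  if q == 0 then 0 else red (insubd 0 (val (repr q))^-1).

Lemma red_eq0 x : (red x == 0) = (x \in val_maximal).
Proof.
by rewrite -(rmorph0 red) /red -Quotient.idealrBE subr0.
Qed.

Fact residue_mulVf (q : residue) : q != 0 -> residue_inv q * q = 1.
Proof.
move=> q0; rewrite /residue_inv (negPf q0) -{2}[q]reprK.
have {q0}: red (repr q) != 0 by rewrite /red reprK.
rewrite -[\pi_residue _]/(red (repr q)).
move: (repr q) => x; rewrite red_eq0 -v_unitE => /andP[x0 /eqP vx].
rewrite -rmorphM -(rmorph1 red); congr (red _); apply: val_inj => /=.
rewrite insubdK ?mulVf //.
by apply/orP; right; rewrite valuationV // vx oppr0.
Qed.

Fact residue_inv0 : residue_inv 0 = 0.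
Proof. by rewrite /residue_inv eqxx. Qed.

HB.instance Definition _ :=
  GRing.ComNzRing_isField.Build residue residue_mulVf residue_inv0.

End ValuationRing.

(* The projective line: lines through the origin in the plane. *)
Definition P1 (k : fieldType) : Type :=
  {U : {vspace 'rV[k]_2} | \dim U == 1%N}.

Section ProjectiveLine.
Variable k : fieldType.

Definition span2 (x y : k) : {vspace 'rV[k]_2} := <[\row_i [:: x; y]`_i]>%VS.

Lemma dim_span2 x y : \dim (span2 x y) = ((x != 0) || (y != 0)) :> nat.
Proof.
rewrite dim_vline -negb_and; congr (nat_of_bool (~~ _)).
apply/eqP/andP => [e|[/eqP -> /eqP ->]]; last first.
  by apply/rowP => i; rewrite !mxE; case: i => [[|[]]].
move: (congr1 (fun M : 'rV_2 => M 0 0) e) (congr1 (fun M : 'rV_2 => M 0 1) e).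
by rewrite !mxE /= => -> ->.
Qed.

Fact dim_span10 : \dim (span2 1 0) == 1%N.
Proof. by rewrite dim_span2 oner_neq0. Qed.

(* The point [x : y]; the junk value for x = y = 0 is [1 : 0]. *)
Definition pt (x y : k) : P1 k := insubd (Sub (span2 1 0) dim_span10) (span2 x y).

(* Some homogeneous coordinates of a point. *)
Definition coord1 (P : P1 k) : 'I_2 -> k := vpick (val P) 0.

Lemma pt_eq x y : (x != 0) || (y != 0) -> val (pt x y) = span2 x y.
Proof. by move=> xy; rewrite val_insubd dim_span2 xy. Qed.

Lemma coord1K P : pt (coord1 P 0) (coord1 P 1) = P.
Proof.
have eP : \row_i [:: coord1 P 0; coord1 P 1]`_i = vpick (val P) :> 'rV[k]_2.
  apply/rowP=> i; rewrite mxE /coord1.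
  by case: i => [[|[|//]]] i /=; congr (fun_of_matrix _ _ _); apply: val_inj.
apply: val_inj; rewrite val_insubd /span2 eP.
have P0 : vpick (val P) != 0 by rewrite vpick0 -dimv_eq0 (eqP (valP P)).
rewrite dim_vline P0 /=; apply/eqP; rewrite eqEdim -memvE memv_pick /=.
by rewrite dim_vline P0 (eqP (valP P)).
Qed.

End ProjectiveLine.

(* Data for a morphism [num : den] of P^1, made of two forms of degree deg. *)
Record formpair (k : fieldType) := FormPair {
  deg : nat;
  num : {mpoly k[2]};
  den : {mpoly k[2]}
}.

(* Two coprime forms: a morphism of P^1 over k, of degree deg Phi. Coprimality
   excludes num = den = 0; degree 0 gives the constant maps. *)
Definition is_morphism (k : fieldType) (Phi : formpair k) : Prop :=
  [/\ num Phi \is (deg Phi).-homog, den Phi \is (deg Phi).-homog &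
      forall D A B, num Phi = D * A -> den Phi = D * B -> D \is a GRing.unit].

Definition base_change (k l : fieldType) (f : {rmorphism k -> l})
    (Phi : formpair k) : formpair l :=
  FormPair (deg Phi) (map_mpoly f (num Phi)) (map_mpoly f (den Phi)).

Section Ramification.
Variables (k : fieldType) (Phi : formpair k).

Definition eval_pt (P : P1 k) : P1 k :=
  pt (num Phi).@[coord1 P] (den Phi).@[coord1 P].

(* A linear form whose only zero on P^1 is P. *)
Definition lin_form (P : P1 k) : {mpoly k[2]} :=
  coord1 P 1 *: 'X_0 - coord1 P 0 *: 'X_1.

(* The order of vanishing at P of the pullback of a local equation of Phi(P). *)
Definition ram_index (P : P1 k) : nat :=
  \max_(e < (deg Phi).+1 | `[< exists A : {mpoly k[2]},
     lin_form (eval_pt P) \mPo [tuple num Phi; den Phi]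
       = lin_form P ^+ e * A >]) e.

Definition ramification_points : set (P1 k) :=
  [set P | (1 < ram_index P)%N]%classic.

Definition branch_points : set (P1 k) :=
  (eval_pt @` ramification_points)%classic.

End Ramification.

(* (E)_w, the points being reduced through coordinates in the valuation ring
   which are not both in the maximal ideal. *)
Definition reduces_to (L : fieldType) (w : valuation L)
    (P : P1 L) (Q : P1 (residue w)) : Prop :=
  exists x y : valring w, [/\ v_unit x || v_unit y,
    P = pt (val x) (val y) & Q = pt (red x) (red y)].
Arguments reduces_to {L} w P Q.

Definition reduction_set (L : fieldType) (w : valuation L) (E : set (P1 L)) :
    set (P1 (residue w)) :=
  [set Q | exists2 P, E P & reduces_to w P Q]%classic.
Arguments reduction_set {L} w E.

(* The ramification points are taken in P^1 over L, where iota : K -> L will be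
   an embedding into an algebraic closure. They are finitely many in
   characteristic 0, so that #= compares finite cardinals. The residue field of
   w is an algebraic closure of that of v when w extends v to L. *)
Definition branch_card_preserved (K L : fieldType) (iota : {rmorphism K -> L})
    (w : valuation L) (Phi : formpair K) : Prop :=
  branch_points (base_change iota Phi)
    #= reduction_set w (branch_points (base_change iota Phi)).

Definition critically_good_reduction (K L : fieldType)
    (iota : {rmorphism K -> L}) (w : valuation L) (Phi : formpair K) : Prop :=
  ramification_points (base_change iota Phi)
    #= reduction_set w (ramification_points (base_change iota Phi)) /\
  branch_card_preserved iota w Phi.

Section Reduction.
Variables (K : fieldType) (v : valuation K).

Definition v_reduced_form (Phi : formpair K) (F G : {mpoly (valring v)[2]}) :
    Prop :=
  (exists2 c : K, c != 0 &
     map_mpoly val F = c *: num Phi /\ map_mpoly val G = c *: den Phi) /\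
  (exists m, v_unit F@_m || v_unit G@_m).

(* Phiv is the reduction of Phi, after cancelling the common factor H. *)
Definition is_reduction (Phi : formpair K) (Phiv : formpair (residue v)) :
    Prop :=
  is_morphism Phiv /\
  exists F G, v_reduced_form Phi F G /\
    exists H, map_mpoly (@red K v) F = H * num Phiv /\
              map_mpoly (@red K v) G = H * den Phiv.

Definition simple_good_reduction (Phi : formpair K) : Prop :=
  exists2 Phiv, is_reduction Phi Phiv & deg Phi = deg Phiv.

End Reduction.
Arguments is_reduction {K} v Phi Phiv.

Section Separability.
Variable k : fieldType.

Definition dehomog (F : {mpoly k[2]}) : {poly k} :=
  mmap polyC (fun i : 'I_2 => if i == 0 then 'X else 1) F.

(* The constant map oo = [1 : 0] counts as the p-th power of itself. *)
Definition is_pth_power (p : nat) (Phi : formpair k) : Prop :=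
  den Phi = 0 \/
  exists r : {fraction {poly k}},
    tofrac (dehomog (num Phi)) / tofrac (dehomog (den Phi)) = r ^+ p.

(* For k perfect of characteristic p, such as a finite field. *)
Definition separable_morphism (p : nat) (Phi : formpair k) : Prop :=
  ~ is_pth_power p Phi.

End Separability.

(* Main.v *)
Require Import Defs.
From HB Require Import structures.
From mathcomp Require Import all_boot all_order all_algebra all_field.
From mathcomp Require Import boolp classical_sets functions cardinality.
From mathcomp Require Import mpoly.
From mathcomp Require Import ring zify.

Set Implicit Arguments.
Unset Strict Implicit.
Unset Printing Implicit Defensive.

Import Order.TTheory GRing.Theory Num.Theory.
Local Open Scope ring_scope.

(** Write [Phi] as f / g in an affine chart, with f and g the dehomogenised
    [v]-reduced forms, and let W = f' g - f g' be their Wronskian. Over the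
    algebraic closure the ramification points are the zeros of W, and where
    f vanishes to order e > 0 and g does not vanish, W vanishes to order
    e - 1 ([mup_wronskian], which needs characteristic 0). Modulo [v] only
    the inequality survives: W_v vanishes to order at least e - 1 where f_v
    vanishes to order e ([mup_wronskian_ge]), and at least e if moreover g_v
    vanishes there ([mup_wronskian_ge_root]). The two sides are compared
    through [disc_roots]: if h has integral coefficients and h_v is not zero,
    then the order of h_v at z is the number of roots of h, with
    multiplicity, in the residue disc of z. Separability is what makes W_v
    nonzero ([separable_wronskian_neq0]), so that this applies to W.

    Critically good reduction implies simple good reduction
    ([single_ramification_no_common_root]): suppose that f_v and g_v both
    vanish at z. Then so does W_v, hence the disc of z contains a ramification
    point t, which is the only one. Exchanging f and g only changes the sign of
    W, and subtracting from f a multiple of g does not change W, so we may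
    assume that f (t) = 0 and g (t) <> 0. If e is the
    order of f at t, then W_v has order exactly e - 1 at z; but f_v has order
    at least e there and g_v vanishes, so that W_v has order at least e.

    Conversely ([single_value_single_ramification]), suppose that f_v and g_v
    have no common zero and that branch points remain distinct. All
    ramification points in the disc of z have images with the same reduction,
    hence the same image, which we may move to 0. If there are r >= 1 of them,
    of indices e_1, ..., e_r, then f_v has order at least e_1 + ... + e_r at z,
    so W_v has order at least e_1 + ... + e_r - 1; but this order is
    (e_1 - 1) + ... + (e_r - 1), whence r <= 1.

    The rest identifies the notions of the theorem with these statements on
    polynomials in each of the two charts: ramification ([ramified_chart]),
    simple good reduction as coprimality of f_v and g_v
    ([simple_good_reductionP]), and equality of finite cardinals as injectivity
    of the reduction ([card_eq_reduction]). *)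

(** * Wronskians *)

Definition wronskian (R : comNzRingType) (f g : {poly R}) : {poly R} :=
  f^`() * g - f * g^`().

Section Wronskian.
Variable R : comNzRingType.
Implicit Types (f g h : {poly R}) (c : R).

Lemma wronskianC f g : wronskian g f = - wronskian f g.
Proof. by rewrite /wronskian; ring. Qed.

Lemma wronskian_subZ f g c : wronskian (f - c *: g) g = wronskian f g.
Proof. by rewrite /wronskian derivB derivZ -!mul_polyC; ring. Qed.

Lemma wronskianM h f g : wronskian (h * f) (h * g) = h ^+ 2 * wronskian f g.
Proof. by rewrite /wronskian !derivM; ring. Qed.

Lemma wronskianZ c f g : wronskian (c *: f) (c *: g) = c ^+ 2 *: wronskian f g.
Proof. by rewrite -!mul_polyC wronskianM -rmorphXn. Qed.

Lemma map_wronskian (S : comNzRingType) (u : {rmorphism R -> S}) f g :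
  map_poly u (wronskian f g) = wronskian (map_poly u f) (map_poly u g).
Proof. by rewrite /wronskian rmorphB !rmorphM /= !deriv_map. Qed.

Lemma wronskian0 f : wronskian 0 f = 0.
Proof. by rewrite /wronskian deriv0 !mul0r subr0. Qed.

Lemma wronskian_common_root f g t :
  root f t -> root g t -> root (wronskian f g) t.
Proof.
move=> /rootP ft /rootP gt; apply/rootP.
by rewrite /wronskian !hornerE ft gt mulr0 mul0r subr0.
Qed.

End Wronskian.

Section WronskianMultiplicity.
Variable F : fieldType.
Implicit Types (f g : {poly F}) (t : F).

Lemma mup_wronskian_ge f g t : wronskian f g != 0 ->
  ((mup t f).-1 <= mup t (wronskian f g))%N.
Proof.
move=> W0; rewrite mup_geq //.
have f0 : f != 0 by apply: contraNneq W0 => ->; rewrite wronskian0.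
have [e|e_gt0] := posnP (mup t f); first by rewrite e expr0 dvd1p.
have : ('X - t%:P) ^+ mup t f %| f by rewrite -mup_geq.
rewrite -(prednK e_gt0) /=; move: (mup t f).-1 => e /dvdpP[q ->].
rewrite /wronskian derivM deriv_exp derivXsubC mul1r /=.
apply/dvdpP; exists (q^`() * ('X - t%:P) * g + q * e.+1%:R * g -
  q * ('X - t%:P) * g^`()).
by rewrite exprS -mulr_natl; ring.
Qed.

(** Both terms f' g and f g' gain a factor from the zero of g, so the loss of
    one order by differentiation is compensated. *)
Lemma mup_wronskian_ge_root f g t : wronskian f g != 0 -> root g t ->
  (mup t f <= mup t (wronskian f g))%N.
Proof.
move=> W0 /factor_theorem[b gE]; rewrite {g}gE in W0 *.
rewrite mup_geq //.
have f0 : f != 0 by apply: contraNneq W0 => ->; rewrite wronskian0.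
have [e|e_gt0] := posnP (mup t f); first by rewrite e expr0 dvd1p.
have : ('X - t%:P) ^+ mup t f %| f by rewrite -mup_geq.
rewrite -(prednK e_gt0) /=; move: (mup t f).-1 => e /dvdpP[q ->].
rewrite /wronskian !derivM deriv_exp !derivXsubC mul1r /=.
apply/dvdpP; exists (q^`() * (b * ('X - t%:P)) + q * e.+1%:R * b -
  q * (b^`() * ('X - t%:P) + b * 1)).
by rewrite exprS -mulr_natl; ring.
Qed.

(** The leading coefficient of f' at t is the multiplicity times a unit, and the
    multiplicity is not zero in F. *)
Lemma mup_wronskian f g t : [pchar F] =i pred0 -> f != 0 -> root f t ->
  ~~ root g t -> mup t (wronskian f g) = (mup t f).-1.
Proof.
move=> F0 f0 ft gt; have [e [q]] := multiplicity_XsubC f t; rewrite f0 /= => qt fE.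
case: e fE => [|e] fE; first by rewrite fE expr0 mulr1 (negPf qt) in ft.
have -> : wronskian f g = (e.+1%:R * q * g + ('X - t%:P) * wronskian q g) *
    ('X - t%:P) ^+ e.
  rewrite fE /wronskian derivM deriv_exp derivXsubC mul1r /= exprS.
  by rewrite -mulr_natl; ring.
rewrite fE !mupMr //; first by rewrite !mup_XsubCX eqxx.
rewrite /root !hornerE subrr mul0r addr0 !mulf_neq0 //.
by rewrite -polyC_natr hornerC; have /pcharf0P -> := F0.
Qed.

End WronskianMultiplicity.

(** * Valuation rings and their residue fields *)

Section ValuationRing.
Variables (L : fieldType) (w : valuation L).
Local Notation O := (valring w).
Local Notation k := (residue w).
Local Notation rd := (@red L w).
Implicit Types (a b : O) (x : L) (z : k).

HB.instance Definition _ := GRing.RMorphism.copy (@valring_val L w)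
  (val : O -> L).

Lemma red_surj z : exists a, red a = z.
Proof. by exists (repr z); rewrite /red reprK. Qed.

Lemma valring_lift x : val_integral w x -> exists a : O, val a = x.
Proof. by move=> xO; exists (ValRing xO). Qed.

Lemma val_eq0 a : (val a == 0) = (a == 0).
Proof. by rewrite -(inj_eq val_inj) rmorph0. Qed.

Lemma valring_mulf_eq0 a b : (a * b == 0) = (a == 0) || (b == 0).
Proof. by rewrite -!val_eq0 rmorphM mulf_eq0. Qed.

Lemma red_neq0 a : (red a != 0) = v_unit a.
Proof. by rewrite red_eq0 v_unitE. Qed.

Lemma valring_total x : val_integral w x || val_integral w x^-1.
Proof.
rewrite /val_integral invr_eq0; have [//|x0] /= := eqVneq x 0.
by rewrite valuationV // oppr_ge0 le_total.
Qed.

(** A valuation ring is a chain: this allows one to normalise projective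
    coordinates. *)
Lemma valring_ratio a b : b != 0 ->
  (exists c, a = c * b) \/ (exists c, b = c * a).
Proof.
rewrite -val_eq0 => b0.
have [] := orP (valring_total (val a / val b)) => /valring_lift[c cE].
  by left; exists c; apply: val_inj; rewrite rmorphM /= cE divfK.
have [a0|a0] := eqVneq (val a) 0.
  by left; exists 0; apply: val_inj; rewrite mul0r rmorph0.
by right; exists c; apply: val_inj; rewrite rmorphM /= cE invf_div divfK.
Qed.

Lemma valring_div a b : red b != 0 -> exists c, a = c * b.
Proof.
rewrite red_neq0 => /andP[b0 /eqP vb].
suff /valring_lift[c cE] : val_integral w (val a / val b).
  by exists c; apply: val_inj; rewrite rmorphM /= cE divfK.
rewrite /val_integral; have [->|a0] := eqVneq (val a) 0.
  by rewrite mul0r eqxx.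
rewrite valuationM ?invr_eq0 // valuationV // vb subr0.
have := valP a; rewrite unfold_in (negPf a0) /= => ->; exact: orbT.
Qed.

Lemma val_or_inv_maximal x : x != 0 ->
  (exists a, val a = x /\ red a = 0) \/ (exists a, val a = x^-1).
Proof.
move=> x0; have [vx|vx] := ltrP 0 (w x).
  have /valring_lift[a ax] : val_integral w x by rewrite /val_integral ltW // orbT.
  left; exists a; split=> //; apply/eqP; rewrite red_eq0 unfold_in ax vx.
  exact: orbT.
right; apply: valring_lift; rewrite /val_integral valuationV // oppr_ge0 vx.
exact: orbT.
Qed.

Lemma map_val_inj : injective (map_poly (val : O -> L)).
Proof.
move=> f g /polyP fg; apply/polyP=> i; apply: val_inj.
by have := fg i; rewrite !coef_map.
Qed.

End ValuationRing.

Section ClosedValuation.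
Variables (L : closedFieldType) (w : valuation L).
Local Notation O := (valring w).
Local Notation k := (residue w).
Local Notation rd := (@red L w).
Local Notation vl := (val : O -> L).
Implicit Types (a b s : O) (x : L) (z : k) (h : {poly O}).

(** A root of the reduction lifts to a root in its residue disc. Move z to 0;
    if no root x of h is small, then h is h (0) times a product of integral
    polynomials 1 - X / x, and h (0) reduces to 0, hence so does h. *)
Lemma root_in_disc h z : map_poly rd h != 0 -> root (map_poly rd h) z ->
  exists2 s, red s = z & root h s.
Proof.
have [z0 <-{z}] := red_surj z => h0 hz.
pose g := h \Po ('X + z0%:P).
have gred : map_poly rd g != 0.
  apply: contraNneq h0 => g0.
  have -> : h = g \Po ('X - z0%:P).
    by rewrite -comp_polyA comp_polyD comp_polyX comp_polyC subrK comp_polyXr.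
  by rewrite map_comp_poly g0 comp_poly0.
have [r gE] := closed_field_poly_normal (map_poly vl g).
have rootg s : root (map_poly vl g) (val s) -> root h (s + z0).
  by rewrite /root horner_map /= val_eq0 horner_comp !hornerE.
have [/hasP[x xr]|] := boolP (has (fun x => (x == 0) || (0 < w x)) r).
  move=> x_small.
  have /valring_lift[s sx] : val_integral w x.
    by case/orP: x_small => [|/ltW] H; rewrite /val_integral H ?orbT.
  exists (s + z0); last first.
    apply: rootg; rewrite gE sx rootZ ?root_prod_XsubC //.
    rewrite lead_coef_eq0; apply: contraNneq gred => g0.
    have -> : g = 0 by apply: map_val_inj; rewrite g0 rmorph0.
    by rewrite rmorph0.
  have /eqP rs : red s == 0 by rewrite red_eq0 unfold_in sx.
  by rewrite rmorphD /= rs add0r.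
move=> /hasPn r_big; case/eqP: gred.
have [q qE] : exists q : {poly O}, map_poly vl q =
    \prod_(x <- r) (1 - x^-1 *: 'X).
  elim: {gE} r r_big => [_|x r IH /= r_big].
    by exists 1; rewrite big_nil rmorph1.
  have [|q qE] := IH; first by move=> y yr; apply: r_big; rewrite inE yr orbT.
  have /norP[x0 vx] := r_big x (mem_head _ _).
  have [[a [ax ra]]|[a ax]] := val_or_inv_maximal w x0.
    move: vx; rewrite -ax; move/eqP: ra; rewrite red_eq0 unfold_in ax.
    by rewrite (negPf x0) /= => ->.
  exists ((1 - a *: 'X) * q); rewrite big_cons -qE.
  by rewrite rmorphM rmorphB rmorph1 /= map_polyZ map_polyX -ax.
have gq : g = g.[0] *: q.
  have g0 : val g.[0] = (map_poly vl g).[0] by rewrite -(rmorph0 vl) horner_map.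
  apply: map_val_inj; rewrite map_polyZ /= qE g0 gE.
  rewrite hornerZ -scalerA; congr (_ *: _).
  rewrite horner_prod -scaler_prod; apply: eq_big_seq => x /r_big /norP[x0 _].
  rewrite !hornerE ?sub0r ?add0r scalerBr scalerA mulNr divff // scaleN1r opprK.
  by rewrite -[(- x) *: 1]mul_polyC mulr1 polyCN addrC.
rewrite gq map_polyZ /=; apply/eqP; rewrite scaler_eq0; apply/orP; left.
have : root (map_poly rd h) (red z0) by [].
by rewrite /root horner_map /g horner_comp !hornerE.
Qed.

End ClosedValuation.

Section Discs.
Variables (L : closedFieldType) (w : valuation L).
Local Notation O := (valring w).
Local Notation k := (residue w).
Local Notation rd := (@red L w).
Local Notation vl := (val : O -> L).
Implicit Types (a b s t : O) (x : L) (z : k) (f g h : {poly O}).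

(** Lift to a monic polynomial over the valuation ring; its roots are
    integral. *)
Lemma residue_closed (p : {poly k}) : (1 < size p)%N -> exists z, root p z.
Proof.
move=> p_gt1; have p0 : p != 0 by rewrite -size_poly_gt0 ltnW.
wlog p_monic : p p_gt1 p0 / p \is monic.
  move=> wl; have c0 : (lead_coef p)^-1 != 0 by rewrite invr_eq0 lead_coef_eq0.
  have [||| z] := wl ((lead_coef p)^-1 *: p); rewrite ?size_scale ?scaler_eq0 //.
  - by rewrite negb_or c0.
  - by rewrite monicE lead_coefZ mulVf // lead_coef_eq0.
  by rewrite rootZ //; exists z.
pose n := (size p).-1.
have pn : size p = n.+1 by rewrite prednK // ltnW.
pose h := \poly_(i < n.+1) (if i == n then 1 else repr p`_i) : {poly O}.
have hp : map_poly rd h = p.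
  apply/polyP=> i; rewrite coef_map coef_poly -pn.
  case: ltnP => [_|pi] /=; last by rewrite rmorph0 nth_default.
  have [->|_] := eqVneq i n; last exact: reprK.
  by rewrite rmorph1; apply/esym/eqP; rewrite -monicE.
have hn : size h = n.+1 by rewrite size_poly_eq //= eqxx oner_neq0.
have /closed_rootP[x hx] : size (map_poly vl h) != 1.
  by rewrite size_map_poly_id0 ?hn -?pn ?gtn_eqF // val_eq0 lead_coef_eq0
     -size_poly_gt0 hn.
have [a ax] : exists a, val a = x.
  have [->|x0] := eqVneq x 0; first by exists 0; rewrite rmorph0.
  have x'0 : x^-1 != 0 by rewrite invr_eq0.
  have [[a [ax ra]]|[a]] := val_or_inv_maximal w x'0; last by rewrite invrK; exists a.
  (* The polynomial with reversed coefficients has constant term 1, so it has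
     no root in the maximal ideal. *)
  have : \sum_(i < n.+1) h`_i * a ^+ (n - i) = 0.
    apply: val_inj; rewrite rmorph0 rmorph_sum.
    move: hx; rewrite /root horner_coef size_map_poly_id0; last first.
      by rewrite val_eq0 lead_coef_eq0 -size_poly_gt0 hn.
    rewrite hn => /eqP/(congr1 ( *%R (x^-1 ^+ n))); rewrite mulr0 mulr_sumr => {2}<-.
    apply: eq_bigr => i _; rewrite coef_map rmorphM rmorphXn /= ax.
    rewrite mulrCA; congr (_ * _); have := ltn_ord i; rewrite ltnS => lin.
    have -> : x^-1 ^+ n = x^-1 ^+ (n - i) * x^-1 ^+ i by rewrite -exprD subnK.
    by rewrite -mulrA -exprMn mulVf // expr1n mulr1.
  move/(congr1 rd)/eqP; rewrite rmorph0 big_ord_recr /= rmorphD rmorph_sum /=.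
  rewrite big1 ?add0r => [|i _]; last first.
    by rewrite rmorphM rmorphXn /= ra expr0n subn_eq0 leqNgt ltn_ord mulr0.
  by rewrite subnn mulr1 coef_poly ltnSn eqxx rmorph1 oner_eq0.
exists (red a); rewrite -hp /root horner_map /=.
suff -> : h.[a] = 0 by rewrite rmorph0.
by apply/eqP; rewrite -val_eq0 -horner_map /= ax.
Qed.

(** The order of vanishing of h_v at z counts the roots of h in the residue disc
    of z: divide by the factors given by [root_in_disc] one after the other. *)
Lemma disc_roots h z : map_poly rd h != 0 ->
  exists ss : seq O, [/\ {in ss, forall s, red s = z},
    mup z (map_poly rd h) = size ss &
    forall s, red s = z -> mup (val s) (map_poly vl h) = count_mem s ss].
Proof.
have [n] := ubnP (size h); elim: n h => // n IH h /ltnSE hn h0.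
have [hz|hz] := boolP (root (map_poly rd h) z); last first.
  exists [::]; split=> // [|s sz]; first by rewrite mupNroot.
  rewrite mupNroot //; apply: contra hz => /eqP hs.
  rewrite -sz /root horner_map /= (_ : h.[s] = 0) ?rmorph0 //.
  by apply/eqP; rewrite -val_eq0 -horner_map; apply/eqP.
have [s0 s0z /factor_theorem[q hE]] := root_in_disc h0 hz.
have q0 : map_poly rd q != 0.
  by apply: contraNneq h0 => q0; rewrite hE rmorphM /= q0 mul0r.
have [|ss [ssz sze cnt]] := IH q _ q0.
  apply: leq_trans hn; rewrite hE size_Mmonic ?monicXsubC //.
    by rewrite size_XsubC addn2.
  by apply: contraNneq q0 => ->; rewrite rmorph0.
have vq0 : map_poly vl q != 0.
  by apply: contraNneq q0 => e; rewrite (_ : q = 0) ?rmorph0 //;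
     apply: map_val_inj; rewrite e rmorph0.
exists (s0 :: ss); split=> [s|| s sz].
- by rewrite inE => /orP[/eqP->|/ssz].
- rewrite hE rmorphM rmorphB /= map_polyX map_polyC /= s0z.
  rewrite mupM ?polyXsubC_eq0 // sze (@mup_XsubCX _ 1) eqxx addn1 //.
rewrite hE rmorphM rmorphB /= map_polyX map_polyC /=.
rewrite mupM ?polyXsubC_eq0 // (@mup_XsubCX _ 1) cnt // addnC.
by rewrite (inj_eq val_inj) eq_sym; case: eqP.
Qed.

End Discs.

(** * Critical points in a residue disc *)

Section DiscWronskian.
Variables (L : closedFieldType) (w : valuation L).
Hypothesis L_char0 : [pchar L] =i pred0.
Local Notation O := (valring w).
Local Notation k := (residue w).
Local Notation rd := (@red L w).
Local Notation vl := (val : O -> L).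
Implicit Types (a b s t : O) (x : L) (z : k) (f g h : {poly O}).

Lemma root_map_val h s : root (map_poly vl h) (val s) = root h s.
Proof. by rewrite /root horner_map /= val_eq0. Qed.

Lemma map_neq0_of_wronskian (R S : comNzRingType) (u : {rmorphism R -> S})
    (f g : {poly R}) :
  map_poly u (wronskian f g) != 0 -> map_poly u f != 0.
Proof. by apply: contraNneq; rewrite map_wronskian => ->; rewrite wronskian0. Qed.

Lemma map_val_neq0 f : map_poly rd f != 0 -> map_poly vl f != 0.
Proof.
apply: contraNneq => f0; suff -> : f = 0 by rewrite rmorph0.
by apply: map_val_inj; rewrite f0 rmorph0.
Qed.

(** If a is the value of f / g at s, then f - a g has the same Wronskian with g as
    f, and it vanishes at s. *)
Lemma disc_wronskian_mup f g s a : map_poly rd (wronskian f g) != 0 ->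
  f.[s] = a * g.[s] -> g.[s] != 0 ->
  mup (val s) (map_poly vl (wronskian f g)) =
    (mup (val s) (map_poly vl (f - a *: g))).-1 /\ root (f - a *: g) s.
Proof.
move=> W0 fs gs; rewrite -(wronskian_subZ f g a) in W0 *.
have hs : root (f - a *: g) s by rewrite /root !hornerE fs subrr.
split=> //; rewrite map_wronskian mup_wronskian ?root_map_val //.
exact/map_val_neq0/(map_neq0_of_wronskian W0).
Qed.

(** If t were the only ramification point in the disc, then W_v would have order
    e - 1 at z, where e is the order of f - a g at t, although g_v vanishes at z
    and f_v - a_v g_v has order at least e there. *)
Lemma another_root_in_disc f g z a :
  map_poly rd (wronskian f g) != 0 -> root (map_poly rd g) z ->
  forall t, red t = z -> f.[t] = a * g.[t] -> g.[t] != 0 ->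
  exists2 s, red s = z /\ root (wronskian f g) s & s != t.
Proof.
move=> W0 gz t tz ft gt; have [Wt ht] := disc_wronskian_mup W0 ft gt.
have [rs [rsz rsn rsc]] := disc_roots z W0.
have [/hasP[s srs st]|/hasPn rst] := boolP (has (predC1 t) rs).
  exists s => //; split; first exact: rsz.
  rewrite -root_map_val -dvdp_XsubCl XsubC_dvd ?map_val_neq0 //.
  by rewrite (rsc _ (rsz _ srs)) -has_count has_pred1.
have rs_t : all (pred1 t) rs.
  by apply/allP => s /rst; rewrite /= negbK.
have W'0 : map_poly rd (wronskian (f - a *: g) g) != 0 by rewrite wronskian_subZ.
have h0 := map_neq0_of_wronskian W'0.
have [ss [ssz ssn ssc]] := disc_roots z h0.
have le_ss : (mup (val t) (map_poly vl (f - a *: g)) <= size ss)%N.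
  by rewrite ssc // count_size.
have := mup_wronskian_ge_root (t := z) (f := map_poly rd (f - a *: g)) _ gz.
rewrite -map_wronskian wronskian_subZ => /(_ W0).
rewrite ssn rsn; move: rs_t; rewrite all_count => /eqP <-.
rewrite -rsc // Wt => le_mup.
have := leq_trans le_ss le_mup.
have : (0 < mup (val t) (map_poly vl (f - a *: g)))%N.
  by rewrite -XsubC_dvd ?map_val_neq0 // dvdp_XsubCl root_map_val.
by case: (mup _ _) => // n _; rewrite ltnn.
Qed.

(** At the ramification point t the coordinates f (t) and g (t) may be
    exchanged, so that one of them is an integral multiple of the other. *)
Lemma single_ramification_no_common_root f g z :
  map_poly rd (wronskian f g) != 0 ->
  (forall s, root (wronskian f g) s -> (f.[s] != 0) || (g.[s] != 0)) ->
  (forall s t, red s = z -> red t = z -> root (wronskian f g) s ->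
     root (wronskian f g) t -> s = t) ->
  ~~ (root (map_poly rd f) z && root (map_poly rd g) z).
Proof.
move=> W0 nc uniq_z; apply/negP => /andP[fz gz].
have [t tz Wt] : exists2 t, red t = z & root (wronskian f g) t.
  apply: (root_in_disc W0); rewrite map_wronskian.
  exact: wronskian_common_root fz gz.
(* The case where the image of t is the integral point a; its inverse is
   covered by exchanging f and g. *)
have aux f' g' a : map_poly rd (wronskian f' g') != 0 ->
    root (map_poly rd g') z -> f'.[t] = a * g'.[t] -> g'.[t] != 0 ->
    (forall s, root (wronskian f' g') s = root (wronskian f g) s) -> False.
  move=> W'0 g'z f't g't eqr.
  have [s [sz Ws] /eqP[]] := another_root_in_disc W'0 g'z tz f't g't.
  by apply: uniq_z => //; rewrite -eqr.
have W'0 : map_poly rd (wronskian g f) != 0 by rewrite wronskianC rmorphN oppr_eq0.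
have eqr s : root (wronskian g f) s = root (wronskian f g) s.
  by rewrite wronskianC /root hornerN oppr_eq0.
have [ft0|ft0] := eqVneq f.[t] 0.
  have := nc t Wt; rewrite ft0 eqxx /= => gt0.
  by apply: (aux f g 0) => //; rewrite mul0r.
have [[c gt]|[c ft]] := valring_ratio g.[t] ft0.
  exact: (aux g f c).
apply: (aux f g c) => //; apply: contraNneq ft0 => gt0.
by rewrite ft gt0 mulr0.
Qed.

(** The roots of f - a g in the disc, where a is the common image, are the roots
    of W together with one more copy of each of them. Hence f_v - a_v g_v
    vanishes at z to the order of W_v plus the number of ramification points
    in the disc, and the order of W_v falls short of it by at most one. *)
Lemma single_value_single_ramification f g z :
  map_poly rd (wronskian f g) != 0 ->
  ~~ (root (map_poly rd f) z && root (map_poly rd g) z) ->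
  (forall s t, red s = z -> red t = z -> root (wronskian f g) s ->
     root (wronskian f g) t -> f.[s] * g.[t] = f.[t] * g.[s]) ->
  forall s t, red s = z -> red t = z -> root (wronskian f g) s ->
     root (wronskian f g) t -> s = t.
Proof.
(* The image is then not the point at infinity, even after reduction. *)
wlog gz : f g / ~~ root (map_poly rd g) z.
  move=> wl W0 nc; have [gz|gz] := boolP (root (map_poly rd g) z); last exact: wl.
  have fz : ~~ root (map_poly rd f) z by rewrite gz andbT in nc.
  have eqr s : root (wronskian f g) s = root (wronskian g f) s.
    by rewrite wronskianC /root hornerN oppr_eq0.
  have W'0 : map_poly rd (wronskian g f) != 0.
    by rewrite wronskianC rmorphN oppr_eq0.
  have nc' : ~~ (root (map_poly rd g) z && root (map_poly rd f) z).
    by rewrite (negPf fz) andbF.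
  move=> eq_val s t sz tz; rewrite !eqr; apply: (wl g f fz W'0 nc') sz tz.
  move=> s' t' sz' tz'; rewrite -!eqr => Ws' Wt'; rewrite mulrC [RHS]mulrC.
  exact/esym/eq_val.
move=> W0 _ eq_val s0 t0 s0z t0z Ws0 Wt0; apply/eqP/negP => /negP neq.
have gs_unit s : red s = z -> red g.[s] != 0.
  by move=> sz; apply: contra gz; rewrite /root -sz horner_map.
have gs_neq0 s : red s = z -> g.[s] != 0.
  by move/gs_unit; apply: contraNneq => ->; rewrite rmorph0.
have [a fa] := valring_div f.[s0] (gs_unit s0 s0z).
have fW s : red s = z -> root (wronskian f g) s -> f.[s] = a * g.[s].
  move=> sz Ws; have := eq_val s s0 sz s0z Ws Ws0; rewrite fa => /eqP.
  rewrite mulrAC -subr_eq0 -mulrBl valring_mulf_eq0 (negPf (gs_neq0 _ s0z)) orbF.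
  by rewrite subr_eq0 => /eqP.
have W'0 : map_poly rd (wronskian (f - a *: g) g) != 0 by rewrite wronskian_subZ.
have h0 := map_neq0_of_wronskian W'0.
have [rs [rsz rsn rsc]] := disc_roots z W0.
have [ss [ssz ssn ssc]] := disc_roots z h0.
have mem_rs s : red s = z -> (s \in rs) = root (wronskian f g) s.
  move=> sz; rewrite -root_map_val -dvdp_XsubCl XsubC_dvd ?map_val_neq0 //.
  by rewrite (rsc _ sz) -has_count has_pred1.
have mem_ss s : red s = z -> (s \in ss) = root (f - a *: g) s.
  move=> sz; rewrite -root_map_val -dvdp_XsubCl XsubC_dvd ?map_val_neq0 //.
  by rewrite (ssc _ sz) -has_count has_pred1.
have rs_ss s : s \in rs -> s \in ss.
  move=> srs; have sz := rsz _ srs; move: srs; rewrite mem_rs // mem_ss // => Ws.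
  by have [] := disc_wronskian_mup W0 (fW _ sz Ws) (gs_neq0 _ sz).
(* At each ramification point f - a g vanishes to one order more than W. *)
have perm_ss : perm_eq ss (undup ss ++ rs).
  apply/allP => s; rewrite !mem_cat mem_undup orbA orbb => /orP s_in; apply/eqP.
  have {s_in} sss : s \in ss by case: s_in => // /rs_ss.
  have sz := ssz _ sss.
  rewrite count_cat (count_uniq_mem _ (undup_uniq ss)) mem_undup sss -ssc // -rsc //.
  have fs : f.[s] = a * g.[s].
    by move: sss; rewrite mem_ss // /root !hornerE subr_eq0 => /eqP.
  have [-> _] := disc_wronskian_mup W0 fs (gs_neq0 _ sz).
  by rewrite add1n prednK // ssc // -has_count has_pred1.
have := mup_wronskian_ge z (f := map_poly rd (f - a *: g)) (g := map_poly rd g).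
rewrite -map_wronskian wronskian_subZ => /(_ W0).
rewrite ssn rsn (perm_size perm_ss) size_cat.
have : (1 < size (undup ss))%N.
  apply: (@uniq_leq_size _ [:: s0; t0]); first by rewrite /= inE neq.
  by move=> s; rewrite mem_undup !inE => /orP[]/eqP->; rewrite rs_ss ?mem_rs.
case: (size (undup ss)) => [|[|n]] // _.
by rewrite addSn /= addSn ltnNge leq_addl.
Qed.

End DiscWronskian.

(** * Binary forms and the two affine charts *)

Section Forms.
Variable R : comNzRingType.
Implicit Types (i j : 'I_2) (F G : {mpoly R[2]}) (f g : {poly R}).

Lemma ord2_case i j : (j == i) || (j == rev_ord i).
Proof. by case: i j => [[|[|//]] ?] [[|[|//]] ?]. Qed.

Lemma rev_ord2_neq i : (rev_ord i == i) = false.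
Proof. by case: i => [[|[|//]] ?]. Qed.

Lemma big_ord2 (T : Type) (x0 : T) (op : Monoid.com_law x0) i (u : 'I_2 -> T) :
  \big[op/x0]_j u j = op (u i) (u (rev_ord i)).
Proof.
rewrite (bigD1 i) //= (bigD1 (rev_ord i)) ?rev_ord2_neq //= big1 ?Monoid.mulm1 //.
by move=> j /andP[/negPf ji /negPf jr]; have := ord2_case i j; rewrite ji jr.
Qed.

(** The chart where the coordinate other than the i-th is 1; [chart 0] is
    [dehomog]. *)
Definition chart i F : {poly R} :=
  mmap polyC (fun j => if j == i then 'X else 1) F.

HB.instance Definition _ i := GRing.RMorphism.copy (chart i)
  (mmap (polyC : R -> {poly R}) (fun j => if j == i then 'X else 1)).

Lemma chartZ i c F : chart i (c *: F) = c *: chart i F.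
Proof. by rewrite /chart mmapZ mul_polyC. Qed.

Lemma chartXi i : chart i 'X_i = 'X.
Proof. by rewrite /chart mmapX mmap1U eqxx. Qed.

Lemma chartXr i : chart i 'X_(rev_ord i) = 1.
Proof. by rewrite /chart mmapX mmap1U rev_ord2_neq. Qed.

Lemma chart_meval i F (t : R) :
  (chart i F).[t] = F.@[fun j => if j == i then t else 1].
Proof.
rewrite /chart /mmap mevalE horner_sum; apply: eq_bigr => m _.
rewrite hornerM hornerC; congr (_ * _); rewrite /mmap1 horner_prod.
by apply: eq_bigr => j _; rewrite horner_exp; case: ifP; rewrite !hornerE.
Qed.

Definition homogenize i (d : nat) f : {mpoly R[2]} :=
  \sum_(n < d.+1) f`_n *: ('X_i ^+ n * 'X_(rev_ord i) ^+ (d - n)).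

Fact homogenize_is_linear i d : linear (homogenize i d).
Proof.
move=> c f g; rewrite /homogenize scaler_sumr -big_split /=.
by apply: eq_bigr => n _; rewrite coefD coefZ scalerDl scalerA.
Qed.
HB.instance Definition _ i d := GRing.isLinear.Build R {poly R} {mpoly R[2]} _
  (homogenize i d) (homogenize_is_linear i d).

Lemma homogenizeXn i d n : (n <= d)%N ->
  homogenize i d 'X^n = 'X_i ^+ n * 'X_(rev_ord i) ^+ (d - n).
Proof.
move=> nd; rewrite /homogenize (bigD1 (Ordinal (nd : n < d.+1)%N)) //=.
rewrite coefXn eqxx scale1r big1 ?addr0 // => m mn.
rewrite coefXn; case: eqP => [e|]; last by rewrite scale0r.
by case/eqP: mn; apply: val_inj.
Qed.

Lemma poly_sumE d f : (size f <= d.+1)%N -> f = \sum_(n < d.+1) f`_n *: 'X^n.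
Proof.
move=> fd; rewrite -(poly_def d.+1 (fun n => f`_n)); apply/polyP => n.
rewrite coef_poly; case: ltnP => // dn.
by rewrite nth_default // (leq_trans fd).
Qed.

(** This transports divisibility from polynomials in a chart to forms. *)
Lemma homogenizeM i d1 d2 f g : (size f <= d1.+1)%N -> (size g <= d2.+1)%N ->
  homogenize i (d1 + d2) (f * g) = homogenize i d1 f * homogenize i d2 g.
Proof.
move=> fd gd; rewrite {1}(poly_sumE fd) {1}(poly_sumE gd).
rewrite mulr_suml linear_sum [X in X * _]/homogenize mulr_suml.
apply: eq_bigr => a _; rewrite mulr_sumr linear_sum [in RHS]/homogenize mulr_sumr.
apply: eq_bigr => b _; have := ltn_ord a; have := ltn_ord b; rewrite !ltnS => bd ad.
rewrite -!scalerAl -!scalerAr !linearZ /= !scalerA mulrC; congr (_ *: _).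
rewrite -exprD homogenizeXn ?leq_add // mulrACA -!exprD; congr (_ * _ ^+ _).
by rewrite addnBA // addnBAC // subnDA.
Qed.

Lemma chart_homogenize i d f : (size f <= d.+1)%N -> chart i (homogenize i d f) = f.
Proof.
move=> fd; rewrite rmorph_sum /= {2}(poly_sumE fd); apply: eq_bigr => n _.
by rewrite chartZ rmorphM !rmorphXn /= chartXi chartXr expr1n mulr1.
Qed.

Lemma chart_coef i F n : (chart i F)`_n = \sum_(m <- msupp F | m i == n) F@_m.
Proof.
rewrite /chart /mmap coef_sum [RHS]big_mkcond; apply: eq_bigr => m _.
rewrite coefCM /mmap1 (big_ord2 _ i) /= eqxx rev_ord2_neq expr1n mulr1 coefXn.
by rewrite eq_sym; case: eqP; rewrite (mulr1, mulr0).
Qed.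

Lemma mdeg_ord2 i (m : 'X_{1..2}) : mdeg m = (m i + m (rev_ord i))%N.
Proof. by rewrite mdegE (big_ord2 _ i). Qed.

Lemma homogenizeK i d F : F \is d.-homog -> homogenize i d (chart i F) = F.
Proof.
move=> /dhomogP Fd; rewrite [in RHS](mpolyE F) /chart /mmap linear_sum.
apply: eq_big_seq => m /Fd md; rewrite mul_polyC linearZ /=; congr (_ *: _).
rewrite /mmap1 (big_ord2 _ i) /= eqxx rev_ord2_neq expr1n mulr1.
have -> : d = (m i + m (rev_ord i))%N by rewrite -mdeg_ord2 -md.
rewrite homogenizeXn ?leq_addr // addKn [in RHS]mpolyXE_id.
by rewrite (big_ord2 _ i).
Qed.

Lemma chart_eq0 i d F : F \is d.-homog -> (chart i F == 0) = (F == 0).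
Proof.
move=> Fd; apply/eqP/eqP => [e|->]; last exact: rmorph0.
by rewrite -(homogenizeK i Fd) e linear0.
Qed.

Lemma size_chart i d F : F \is d.-homog -> (size (chart i F) <= d.+1)%N.
Proof.
move=> /dhomogP Fd; apply/leq_sizeP => n dn; rewrite chart_coef big_seq_cond big1 //.
move=> m /andP[/Fd md /eqP mn]; move: dn; rewrite -mn ltnNge => /negP[].
by rewrite -md [X in (_ <= X)%N](mdeg_ord2 i) leq_addr.
Qed.

Lemma chart_coef_rev i d F n : F \is d.-homog -> (n <= d)%N ->
  (chart i F)`_n = (chart (rev_ord i) F)`_(d - n).
Proof.
move=> /dhomogP Fd nd; rewrite !chart_coef big_seq_cond [RHS]big_seq_cond.
apply: eq_bigl => m; have [/Fd md|//] /= := boolP (m \in msupp F).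
have dE : d = (m i + m (rev_ord i))%N by rewrite -mdeg_ord2 -md.
by apply/eqP/eqP; move: nd; rewrite dE; lia.
Qed.

End Forms.

Lemma map_chart (R S : comNzRingType) (u : {rmorphism R -> S}) i F :
  map_poly u (chart i F) = chart i (map_mpoly u F).
Proof.
rewrite [map_mpoly u F]/mmap {1}/chart [in LHS]/mmap !rmorph_sum.
apply: eq_bigr => m _; rewrite !rmorphM /= map_polyC /= {1}/chart mmapC.
congr (_ * _); rewrite !rmorph_prod; apply: eq_bigr => j _.
rewrite !rmorphXn /= /chart mmapX mmap1U.
by case: ifP; rewrite ?map_polyX ?rmorph1.
Qed.

Lemma map_homog (R S : comNzRingType) (u : {rmorphism R -> S}) d
    (F : {mpoly R[2]}) : F \is d.-homog -> map_mpoly u F \is d.-homog.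
Proof.
move=> /dhomogP Fd; apply/dhomogP => m; rewrite mcoeff_msupp mcoeff_map_mpoly => um.
by apply: Fd; rewrite mcoeff_msupp; apply: contraNneq um => ->; rewrite raddf0.
Qed.

Section FormsOverField.
Variable k : fieldType.
Implicit Types (i : 'I_2) (F : {mpoly k[2]}) (D : {poly k}) (Phi : formpair k).

Lemma chart_dvd i d F D : F \is d.-homog -> D != 0 -> D %| chart i F ->
  exists A, F = homogenize i (size D).-1 D * A.
Proof.
move=> Fd D0 /dvdpP[q qE]; have [->|F0] := eqVneq F 0.
  by exists 0; rewrite mulr0.
have cF0 : q * D != 0 by rewrite -qE (chart_eq0 i Fd).
have q0 : q != 0 by apply: contraNneq cF0 => ->; rewrite mul0r.
move: (size_poly_gt0 q) (size_poly_gt0 D) (size_chart i Fd).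
rewrite q0 D0 qE size_mul // => q_gt0 D_gt0 qDd.
exists (homogenize i (d - (size D).-1) q).
have [sd sD sq] : [/\ ((size D).-1 <= d)%N, (size D <= (size D).-1.+1)%N &
    (size q <= (d - (size D).-1).+1)%N].
  move: q_gt0 D_gt0 qDd; case: (size q) => // a; case: (size D) => // b _ _.
  by rewrite addnS addSn /= ltnS => ab; split; lia.
rewrite -homogenizeM //.
by rewrite subnKC // mulrC -qE homogenizeK.
Qed.

(** A common divisor in a chart homogenises to a common divisor of the two
    forms. This is a unit, hence does not vanish at the origin, which forces its
    degree to be 0. *)
Lemma coprime_chart i Phi : is_morphism Phi ->
  coprimep (chart i (num Phi)) (chart i (den Phi)).
Proof.
case=> nd dd cop; set a := chart i _; set b := chart i _.
have [g0|g0] := eqVneq (gcdp a b) 0.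
  move/eqP: g0; rewrite gcdp_eq0 (chart_eq0 i nd) (chart_eq0 i dd).
  move=> /andP[/eqP n0 /eqP d0].
  by have := cop 0 0 0; rewrite n0 d0 mulr0 unitr0 => /(_ erefl erefl).
have [A AE] := chart_dvd nd g0 (dvdp_gcdl a b).
have [B BE] := chart_dvd dd g0 (dvdp_gcdr a b).
have U := cop _ _ _ AE BE; rewrite /coprimep.
case s: (size (gcdp a b)) => [|[|n]] //.
  by move/eqP: s; rewrite size_poly_eq0 (negPf g0).
have := congr1 (meval (fun=> 0)) (mulrV U); rewrite rmorphM rmorph1 /=.
rewrite (_ : meval _ (homogenize _ _ _) = 0); last first.
  rewrite s /homogenize rmorph_sum big1 //= => m _.
  rewrite mevalZ rmorphM !rmorphXn /= !mevalXU -exprD subnKC; last by rewrite -ltnS.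
  by rewrite expr0n mulr0.
by rewrite mul0r => /esym/eqP; rewrite oner_eq0.
Qed.

(** The coefficient of degree d in a chart is the value at the point at infinity,
    which is the origin of the other chart. *)
Lemma coprime_lead_coef i d (F G : {mpoly k[2]}) :
  F \is d.-homog -> G \is d.-homog ->
  coprimep (chart (rev_ord i) F) (chart (rev_ord i) G) ->
  ((chart i F)`_d != 0) || ((chart i G)`_d != 0).
Proof.
move=> Fd Gd cop; rewrite (chart_coef_rev i Fd) // (chart_coef_rev i Gd) //.
rewrite subnn -!horner_coef0; have := coprimep_root (x := 0) cop.
by rewrite /root; case: eqVneq => //= _; apply.
Qed.

Lemma morphism_lead_coef i Phi : is_morphism Phi ->
  ((chart i (num Phi))`_(deg Phi) != 0) || ((chart i (den Phi))`_(deg Phi) != 0).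
Proof.
move=> Phi_mor; have [nd dd _] := Phi_mor.
exact/(coprime_lead_coef nd dd)/coprime_chart.
Qed.

Section CommonFactor.
Variables (d : nat) (F G H : {mpoly k[2]}) (Psi : formpair k).
Hypotheses (Fd : F \is d.-homog) (Gd : G \is d.-homog).
Hypotheses (Psi_mor : is_morphism Psi).
Hypotheses (FE : F = H * num Psi) (GE : G = H * den Psi).

Lemma chart_common_factor_neq0 i : (F != 0) || (G != 0) -> chart i H != 0.
Proof.
rewrite -(chart_eq0 i Fd) -(chart_eq0 i Gd) FE GE !rmorphM /=.
by apply: contraTneq => ->; rewrite !mul0r eqxx.
Qed.

Lemma wronskian_common_factor_neq0 i : (F != 0) || (G != 0) ->
  wronskian (chart i (num Psi)) (chart i (den Psi)) != 0 ->
  wronskian (chart i F) (chart i G) != 0.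
Proof.
move=> FG0 W0; rewrite FE GE !rmorphM /= wronskianM mulf_neq0 //.
by rewrite expf_neq0 // chart_common_factor_neq0.
Qed.

(** One of the forms of [Psi] has the maximal degree d in the chart, which leaves
    no room for a nonconstant common factor. *)
Lemma coprime_of_same_degree i : (F != 0) || (G != 0) -> d = deg Psi ->
  coprimep (chart i F) (chart i G).
Proof.
move=> FG0 dE; have h0 := chart_common_factor_neq0 i FG0.
suff h1 : size (chart i H) = 1%N.
  have /size_poly1P[c c0 hE] : size (chart i H) == 1%N by rewrite h1.
  rewrite FE GE !rmorphM /= hE !mul_polyC coprimepZl // coprimepZr //.
  exact: coprime_chart.
have h_small (C : {mpoly k[2]}) : H * C \is d.-homog -> (chart i C)`_d != 0 ->
    size (chart i H) = 1%N.
  move=> HCd Cd; have C_gt : (d < size (chart i C))%N.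
    by rewrite ltnNge; apply: contra Cd => /(nth_default 0) ->.
  have C0 : chart i C != 0 by rewrite -size_poly_gt0; apply: leq_trans C_gt.
  have := size_chart i HCd; rewrite rmorphM /= size_mul //.
  have : (0 < size (chart i H))%N by rewrite size_poly_gt0.
  move: C_gt; case: (size (chart i C)) => // c; case: (size (chart i H)) => // h.
  by rewrite addnS addSn /=; move=> *; congr _.+1; lia.
have := morphism_lead_coef i Psi_mor; rewrite -dE => /orP[]; apply: h_small.
  by rewrite -FE.
by rewrite -GE.
Qed.

Lemma same_degree_of_coprime :
  (forall i, coprimep (chart i F) (chart i G)) -> d = deg Psi.
Proof.
move=> cop; have h1 i : size (chart i H) = 1%N.
  apply/eqP; rewrite -coprimepp; apply: coprimep_dvdl (_ : _ %| chart i G) _.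
    by rewrite GE rmorphM dvdp_mulr.
  by apply: coprimep_dvdr (cop i); rewrite FE rmorphM dvdp_mulr.
have sizeM (C : {mpoly k[2]}) : size (chart 0 (H * C)) = size (chart 0 C).
  rewrite rmorphM /=.
  have /size_poly1P[c c0 ->] : size (chart 0 H) == 1%N by rewrite h1.
  by rewrite mul_polyC size_scale.
have gt_coef (f : {poly k}) n : f`_n != 0 -> (n < size f)%N.
  by rewrite ltnNge; apply: contra => /(nth_default 0) ->.
have [nd dd _] := Psi_mor.
apply/eqP; rewrite eqn_leq -ltnS -[X in _ && X]ltnS; apply/andP; split.
  have /orP[] := coprime_lead_coef Fd Gd (cop (rev_ord 0)) => /gt_coef.
    by rewrite FE sizeM => /leq_trans; apply; exact: size_chart nd.
  by rewrite GE sizeM => /leq_trans; apply; exact: size_chart dd.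
have /orP[] := morphism_lead_coef 0 Psi_mor => /gt_coef.
  by rewrite -sizeM -FE => /leq_trans; apply; exact: size_chart.
by rewrite -sizeM -GE => /leq_trans; apply; exact: size_chart.
Qed.

End CommonFactor.

End FormsOverField.

(** * Points of the projective line *)

Section Points.
Variable k : fieldType.
Implicit Types (i : 'I_2) (x y c t : k) (P : P1 k).

Lemma pt_scale c x y : c != 0 -> pt (c * x) (c * y) = pt x y.
Proof.
move=> c0; rewrite /pt; congr (insubd _ _); rewrite /span2.
have -> : \row_i [:: c * x; c * y]`_i = c *: \row_i [:: x; y]`_i :> 'rV[k]_2.
  by apply/rowP => j; rewrite !mxE; case: j => [[|[|//]] ?].
apply/eqP; rewrite eqEsubv -!memvE memvZ ?memv_line //=.
by rewrite -[X in X \in _](scalerK c0) memvZ // memv_line.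
Qed.

Lemma coord1_pt x y : (x != 0) || (y != 0) ->
  exists2 c, c != 0 & coord1 (pt x y) 0 = c * x /\ coord1 (pt x y) 1 = c * y.
Proof.
move=> xy; have := memv_pick (val (pt x y)); rewrite pt_eq // => /vlineP[c cE].
exists c; last by rewrite /coord1 pt_eq // cE !mxE.
apply: contraTneq (valP (pt x y)) => c0.
have : vpick (val (pt x y)) == 0 by rewrite pt_eq // cE c0 scale0r.
by rewrite vpick0 -dimv_eq0 => /eqP ->.
Qed.

Lemma pt_eqP x y x' y' : (x != 0) || (y != 0) -> (x' != 0) || (y' != 0) ->
  pt x y = pt x' y' <-> x * y' = x' * y.
Proof.
move=> xy xy'; split=> [e|e].
  have [c c0 [cx cy]] := coord1_pt xy; have [c' c'0 [cx' cy']] := coord1_pt xy'.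
  have ex : c * x = c' * x' by rewrite -cx e.
  have ey : c * y = c' * y' by rewrite -cy e.
  apply: (mulfI (mulf_neq0 c0 c'0)).
  have -> : c * c' * (x * y') = c * x * (c' * y') by ring.
  by rewrite ex -ey; ring.
suff [c c0 [-> ->]] : exists2 c, c != 0 & x' = c * x /\ y' = c * y.
  by rewrite pt_scale.
have [x0|x0] := eqVneq x 0.
  move: xy e; rewrite x0 eqxx mul0r /= => y0 /esym/eqP.
  rewrite mulf_eq0 (negPf y0) orbF => /eqP x'0; move: xy'; rewrite x'0 eqxx /= => y'0.
  by exists (y' / y); rewrite ?mulf_neq0 ?invr_eq0 // mulr0 divfK.
exists (x' / x); last by rewrite divfK // mulrAC -e mulrAC divff // mul1r.
rewrite mulf_neq0 ?invr_eq0 //; apply: contraTneq xy' => x'0.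
move/eqP: e; rewrite x'0 mul0r mulf_eq0 (negPf x0) /= => /eqP->.
by rewrite eqxx.
Qed.

Definition chart_pt i t : P1 k :=
  pt (if 0 == i then t else 1) (if 1 == i then t else 1).

Lemma chart_pt_neq0 i t :
  ((if 0 == i then t else 1) != 0) || ((if 1 == i then t else 1) != 0).
Proof. by case: i => [[|[|//]] ?]; rewrite /= oner_neq0 ?orbT. Qed.

Lemma chart_pt_inj i : injective (chart_pt i).
Proof.
move=> s t /(pt_eqP (chart_pt_neq0 i s) (chart_pt_neq0 i t)).
by case: i => [[|[|//]] ?] /=; rewrite !(mul1r, mulr1).
Qed.

Lemma chart_ptP P : (exists t, P = chart_pt 0 t) \/ P = chart_pt 1 0.
Proof.
rewrite -(coord1K P); set x := coord1 P 0; set y := coord1 P 1.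
have xy : (x != 0) || (y != 0).
  apply: contraTT (valP P); rewrite negb_or !negbK => /andP[/eqP x0 /eqP y0].
  rewrite (_ : \dim _ = 0%N) //; apply/eqP; rewrite dimv_eq0 -vpick0; apply/eqP.
  by apply/rowP => j; rewrite mxE; case/orP: (ord2_case 0 j) => /eqP->;
    [exact: x0 | rewrite -[RHS]y0; congr (_ _ _); apply: val_inj].
have [y0|y0] := eqVneq y 0; last first.
  left; exists (x / y); rewrite /chart_pt /=.
  by rewrite -(pt_scale (x / y) 1 y0) mulrCA divff // !mulr1.
right; rewrite /chart_pt /= y0 in xy *; rewrite eqxx orbF in xy.
by rewrite -(pt_scale 1 0 xy) mulr1 mulr0.
Qed.

End Points.

(** * Ramification is the vanishing of the Wronskian *)

Section RamificationInCharts.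
Variable k : fieldType.
Implicit Types (i : 'I_2) (t c : k) (F : {mpoly k[2]}) (h : {poly k}).

Lemma dvdp_XsubC_sqr h t : (('X - t%:P) ^+ 2 %| h) = root h t && root h^`() t.
Proof.
apply/idP/andP => [/dvdpP[q ->]|[/factor_theorem[q ->]]].
  rewrite expr2 mulrA /root !derivM derivXsubC !hornerE subrr.
  by rewrite !(mulr0, mul0r, addr0) eqxx.
rewrite derivM derivXsubC mulr1 /root !hornerE subrr mulr0 add0r => qt.
by rewrite expr2 dvdp_mul2r ?polyXsubC_eq0 // dvdp_XsubCl.
Qed.

Lemma meval_scale d F c (u v : 'I_2 -> k) : F \is d.-homog ->
  (forall j, u j = c * v j) -> F.@[u] = c ^+ d * F.@[v].
Proof.
move=> /dhomogP Fd uv; rewrite !mevalE mulr_sumr.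
apply: eq_big_seq => m /Fd md; rewrite mulrCA; congr (_ * _).
have -> : d = (\sum_j m j)%N by rewrite -mdegE -md.
rewrite -prodrXr -big_split /=; apply: eq_bigr => j _.
by rewrite uv exprMn.
Qed.

Lemma chart_lin_form i t : exists2 c, c != 0 &
  lin_form (chart_pt i t) = c *: homogenize i 1 ('X - t%:P).
Proof.
have [c c0 [c1 c2]] := coord1_pt (chart_pt_neq0 i t).
rewrite /lin_form /chart_pt c1 c2.
rewrite /homogenize !big_ord_recl big_ord0 addr0 !coefB !coefX !coefC /=.
rewrite subr0 sub0r !expr0 !expr1 mul1r mulr1.
have r0 : rev_ord 0 = 1 :> 'I_2 by apply: val_inj.
have r1 : rev_ord 1 = 0 :> 'I_2 by apply: val_inj.
case/orP: (ord2_case 0 i) => /eqP-> {c1 c2}; rewrite ?r0 ?r1 /= mulr1 scale1r.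
  by exists c => //; rewrite scalerDr scaleNr scalerN scalerA addrC.
exists (- c); rewrite ?oppr_eq0 //.
by rewrite scalerDr !scaleNr scalerN opprK scalerA.
Qed.

Variable Psi : formpair k.
Hypothesis num_homog : num Psi \is (deg Psi).-homog.
Hypothesis den_homog : den Psi \is (deg Psi).-homog.

Lemma eval_chart_pt i t :
  eval_pt Psi (chart_pt i t) = pt (chart i (num Psi)).[t] (chart i (den Psi)).[t].
Proof.
have [c c0 [c1 c2]] := coord1_pt (chart_pt_neq0 i t).
have cE (j : 'I_2) : coord1 (chart_pt i t) j = c * (if j == i then t else 1).
  case/orP: (ord2_case 0 j) => /eqP->; first exact: c1.
  by rewrite (_ : rev_ord 0 = 1) ?c2 //; apply: val_inj.
rewrite /eval_pt (meval_scale num_homog cE) (meval_scale den_homog cE).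
by rewrite pt_scale ?expf_neq0 // !chart_meval.
Qed.

(** The pullback of a local equation at the image of t is g (t) f - f (t) g in the
    chart. It always vanishes at t, and its derivative there is W (t). *)
Lemma ramified_chart i t : (1 < deg Psi)%N ->
  coprimep (chart i (num Psi)) (chart i (den Psi)) ->
  (1 < ram_index Psi (chart_pt i t))%N =
    root (wronskian (chart i (num Psi)) (chart i (den Psi))) t.
Proof.
move=> d_gt1 cop; set f := chart i (num Psi) in cop *.
set g := chart i (den Psi) in cop *.
have fg0 : (f.[t] != 0) || (g.[t] != 0).
  have := coprimep_root (x := t) cop; rewrite /root.
  by case: eqVneq => //= _; apply.
have [e e0 [e1 e2]] := coord1_pt fg0.
pose E := lin_form (eval_pt Psi (chart_pt i t)) \mPo [tuple num Psi; den Psi].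
have EE : E = e *: (g.[t] *: num Psi - f.[t] *: den Psi).
  rewrite /E /lin_form eval_chart_pt e1 e2 rmorphB /= !comp_mpolyZ !comp_mpolyXU /=.
  by rewrite scalerBr !scalerA.
have Ed : E \is (deg Psi).-homog.
  by rewrite EE dhomogZ // dhomogD ?dhomogN ?dhomogZ.
have cE : chart i E = e *: (g.[t] *: f - f.[t] *: g).
  by rewrite EE chartZ rmorphB /= !chartZ.
have dvdE : (('X - t%:P) ^+ 2 %| chart i E) = root (wronskian f g) t.
  rewrite cE dvdpZr // dvdp_XsubC_sqr derivB !derivZ /root !hornerE.
  by rewrite mulrC subrr eqxx /= [g.[t] * _]mulrC.
have [c c0 linE] := chart_lin_form i t.
rewrite -dvdE; apply/idP/idP.
  rewrite ltnNge; apply: contraR => ndvd; apply/bigmax_leqP => -[n /= n_lt] /asboolP[A].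
  rewrite -/E => EA; rewrite leqNgt; apply: contra ndvd => n_gt1.
  rewrite EA rmorphM rmorphXn /= linE chartZ chart_homogenize ?size_XsubC //.
  rewrite dvdp_mulr // exprZn dvdpZr ?expf_neq0 // dvdp_exp2l //.
have sX : size (('X - t%:P) ^+ 2) = 3 by rewrite size_exp_XsubC.
move=> /(chart_dvd Ed)[|A EA]; first by rewrite -size_poly_gt0 sX.
have lt2 : (2 < (deg Psi).+1)%N by [].
rewrite /ram_index (bigD1 (Ordinal lt2)) ?leq_max //=; apply/asboolP.
exists (c ^- 2 *: A); rewrite -/E EA sX /= expr2 (@homogenizeM _ i 1 1) ?size_XsubC //.
rewrite linE -expr2 exprZn -scalerAl -scalerAr scalerA divff ?expf_neq0 //.
by rewrite scale1r.
Qed.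

End RamificationInCharts.

(** * Separability *)

Section Perfect.
Variables (F : fieldType) (p : nat).
Hypothesis Fp : p \in [pchar F].
Implicit Types (f g : {poly F}) (y z : F).

(** Integers are fixed by Frobenius. *)
Lemma root_frobenius (P : {poly int}) y :
  root (map_poly intr P) y -> root (map_poly intr P) (y ^+ p).
Proof.
rewrite /root => /eqP Py; rewrite -(pFrobenius_autE Fp).
have <- : map_poly (pFrobenius_aut Fp) (map_poly intr P) = map_poly intr P.
  by apply/polyP => i; rewrite !coef_map /= rmorph_int.
by rewrite horner_map Py rmorph0.
Qed.

(** The iterates of Frobenius on y are roots of P, so two of them coincide; as
    Frobenius is injective, y itself is an iterate of Frobenius on y. *)
Lemma algebraic_pth_root (P : {poly int}) y : map_poly intr P != 0 :> {poly F} ->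
  root (map_poly intr P) y -> exists z, y = z ^+ p.
Proof.
move=> P0 Py; pose orb n := y ^+ (p ^ n).
have orbP n : root (map_poly intr P) (orb n).
  elim: n => [|n IH]; first by rewrite /orb expr1.
  by rewrite /orb expnSr exprM root_frobenius.
have inj m : injective (fun u : F => u ^+ (p ^ m)).
  elim: m => [|m IH] a b; first by rewrite !expr1.
  rewrite expnS !exprM => /IH; rewrite -!(pFrobenius_autE Fp).
  exact: fmorph_inj.
have : ~~ uniq [seq orb n | n <- iota 0 (size (map_poly intr P : {poly F}))].
  apply/negP => uq; have := max_poly_roots P0 _ uq.
  rewrite size_map size_iota ltnn => /implyP; apply/negP; rewrite negb_imply /= andbT.
  by apply/allP => _ /mapP[n _ ->].
case/(uniqPn 0) => i [j [ij]]; rewrite size_map size_iota => js.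
rewrite !(nth_map 0) ?size_iota ?(ltn_trans ij) // !nth_iota ?(ltn_trans ij) // !add0n.
rewrite /orb -(subnK (ltnW ij)) expnD exprM => /inj ->.
exists (orb (j - i).-1); rewrite /orb -exprM -expnSr prednK ?subn_gt0 //.
Qed.

Lemma deriv_eq0_coef f n : f^`() = 0 -> f`_n != 0 -> (p %| n)%N.
Proof.
case: n => // n f'0 fn; rewrite (dvdn_pcharf Fp).
have /esym/eqP := coef_deriv f n; rewrite f'0 coef0 -[_ *+ _]mulr_natr mulf_eq0.
by rewrite (negPf fn).
Qed.

Hypothesis F_perfect : forall y, exists z, y = z ^+ p.

Lemma poly_pth_root f : (forall n, f`_n != 0 -> (p %| n)%N) ->
  exists r, f = r ^+ p.
Proof.
move=> fp; have [z zE] := choice F_perfect.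
have Xp : p \in [pchar {poly F}] by rewrite pchar_poly.
have p_gt0 : (0 < p)%N by rewrite prime_gt0 // (pcharf_prime Fp).
exists (\sum_(i < size f) (z f`_(i * p))%:P * 'X^i).
rewrite -(pFrobenius_autE Xp) rmorph_sum; apply/polyP => n; rewrite coef_sum.
under eq_bigr => i _.
  rewrite /= pFrobenius_autE exprMn -rmorphXn /= -zE -exprM coefCM coefXn.
  over.
have [/dvdnP[m nm]|pn] := boolP (p %| n)%N; last first.
  rewrite big1 => [|i _].
    by apply/eqP; apply: contraR pn => /fp.
  by case: eqP pn => [->|_]; rewrite ?dvdn_mull ?mulr0.
rewrite nm; have [mf|fm] := ltnP m (size f); last first.
  rewrite nth_default ?(leq_trans fm) ?leq_pmulr // big1 // => i _.
  rewrite eqn_pmul2r // gtn_eqF ?mulr0 //; exact: leq_trans (ltn_ord i) fm.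
rewrite (bigD1 (Ordinal mf)) //= eqxx mulr1 big1 ?addr0 // => i im.
by rewrite eqn_pmul2r // eq_sym (_ : (_ == _) = false) ?mulr0 //; apply: negPf.
Qed.

(** From f' g = f g' and coprimality, f divides f', which has smaller degree. *)
Lemma coprime_wronskian0 f g : coprimep f g -> wronskian f g = 0 ->
  f^`() = 0 /\ g^`() = 0.
Proof.
have aux a b : coprimep a b -> wronskian a b = 0 -> a^`() = 0.
  move=> ab /subr0_eq W0; have [->|a0] := eqVneq a 0; first exact: deriv0.
  apply: contraTeq (lt_size_deriv a0) => a'0; rewrite -leqNgt; apply: dvdp_leq => //.
  by rewrite -(Gauss_dvdpl _ ab) W0 dvdp_mulIl.
move=> fg W0; split; first exact: aux W0.
by apply: aux (_ : coprimep g f) _; rewrite 1?coprimep_sym // wronskianC W0 oppr0.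
Qed.

(** If W = 0 in the i-th chart, all exponents there are multiples of p. So is the
    degree of [Phi], as one of the forms has maximal degree in this chart; hence
    the exponents in the other chart, too, are multiples of p, and since F is
    perfect [Phi] is a p-th power. *)
Lemma separable_wronskian_neq0 i (Phi : formpair F) : is_morphism Phi ->
  separable_morphism p Phi ->
  wronskian (chart i (num Phi)) (chart i (den Phi)) != 0.
Proof.
move=> Phi_mor sep; apply/eqP => W0; apply: sep; right.
have [nd dd _] := Phi_mor.
have [n'0 d'0] := coprime_wronskian0 (coprime_chart i Phi_mor) W0.
have p_deg : (p %| deg Phi)%N.
  by have /orP[] := morphism_lead_coef i Phi_mor; apply: deriv_eq0_coef.
have exps (G : {mpoly F[2]}) : G \is (deg Phi).-homog -> (chart i G)^`() = 0 ->
    exists r, dehomog G = r ^+ p.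
  move=> Gd G'0; have [n|r rE] := @poly_pth_root (chart 0 G); last by exists r.
  have /orP[/eqP i0|/eqP i1] := ord2_case i 0.
    by rewrite i0; exact: deriv_eq0_coef.
  have [nd'|dn] := leqP n (deg Phi); last first.
    by rewrite nth_default ?eqxx // (leq_trans (size_chart 0 Gd)).
  rewrite (chart_coef_rev 0 Gd nd') i1 rev_ordK => /(deriv_eq0_coef G'0).
  by rewrite dvdn_subr.
have [r ->] := exps _ nd n'0; have [s ->] := exps _ dd d'0.
by exists (tofrac r / tofrac s); rewrite !rmorphXn expr_div_n.
Qed.

End Perfect.

(** An element of K is a root of a primitive integral polynomial, which does not
    vanish modulo p; hence every element of the residue field is algebraic over
    the prime field. *)
Lemma residue_perfect (K : fieldExtType rat) (v : valuation K) p
    (y : residue v) : p \in [pchar residue v] -> exists z, y = z ^+ p.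
Proof.
move=> kp; have [x <-{y}] := red_surj y.
have [q q0 qx] : exists2 q : {poly rat},
    q != 0 & root (map_poly (in_alg K : rat -> K) q) (val x).
  have /polyOver1P[q qE] := minPolyOver 1 (val x).
  exists q; last by rewrite -qE root_minPoly.
  have := monic_neq0 (monic_minPoly 1 (val x)); rewrite qE.
  by apply: contraNneq => ->; rewrite rmorph0.
have [P [a a0 qE]] := rat_poly_scale q.
have P0 : P != 0.
  by apply: contraNneq q0 => P0; rewrite qE P0 rmorph0 scaler0.
pose P1 := zprimitive P.
have P1K : root (map_poly intr P1) (val x).
  have cP0 : (zcontents P)%:~R != 0 :> K.
    by rewrite -(rmorph_int (in_alg K)) fmorph_eq0 intr_eq0 zcontents_eq0.
  have a'0 : in_alg K a%:~R^-1 != 0 by rewrite fmorph_eq0 invr_eq0 intr_eq0.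
  move: qx; rewrite qE (zpolyEprim P) map_polyZ rootZ //.
  rewrite -map_poly_comp (eq_map_poly (g := intr)) => [|n]; last exact: rmorph_int.
  by rewrite map_polyZ rootZ.
have P1x : (map_poly intr P1).[x] = 0.
  apply: val_inj; rewrite rmorph0 -horner_map -map_poly_comp.
  by rewrite (eq_map_poly (g := intr)) => [|n]; [apply/eqP | exact: rmorph_int].
apply: (algebraic_pth_root kp (P := P1)); last first.
  rewrite /root -(eq_map_poly (f := @red K v \o intr)) => [|n]; last exact: rmorph_int.
  by rewrite map_poly_comp horner_map P1x rmorph0.
apply/eqP => P1k.
have : (p %| zcontents P1)%Z.
  rewrite dvdz_contents; apply/polyOverP => n.
  rewrite -[_ \in _]/((p %| P1`_n)%Z) (dvdz_pcharf kp).
  by rewrite -[_%:~R](coef_map intr) P1k coef0.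
by rewrite zcontents_primitive P0 dvdz1 absz_nat; case: p kp => [|[|]].
Qed.

(** * Reduction of points and cardinals *)

Local Open Scope card_scope.

(** A finite set has as many elements as its image by a function only if this
    function is injective on it. *)
Lemma card_eq_functional_image (T U : Type) (A : set T) (r : T -> U -> Prop) :
  (forall P, exists Q, r P Q) -> (forall P Q Q', r P Q -> r P Q' -> Q = Q') ->
  finite_set A ->
  A #= [set Q | exists2 P, A P & r P Q]%classic <->
  (forall P P' Q, A P -> A P' -> r P Q -> r P' Q -> P = P').
Proof.
move=> /choice[f rf] r_fun A_fin.
elim/Pchoice: T => T in A r f rf r_fun A_fin *.
elim/Pchoice: U => U in r f rf r_fun *.
have -> : [set Q | exists2 P, A P & r P Q]%classic = (f @` A)%classic.
  apply/seteqP; split=> Q /= [P AP PQ]; exists P => //; last by rewrite -PQ.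
  exact: r_fun (rf P) PQ.
split=> [cardA P P' Q AP AP' PQ P'Q|inj].
  have [n An] := A_fin.
  have fAn : (f @` A)%classic #= `I_n.
    by rewrite card_eq_sym in cardA; exact: card_eq_trans cardA An.
  have := card_fset_set fAn; rewrite -(card_fset_set An) fset_set_image //.
  move/eqP/finmap.card_in_imfsetP => finj; apply: finj; rewrite ?in_fset_set ?inE //.
  by rewrite (r_fun _ _ _ (rf P) PQ) (r_fun _ _ _ (rf P') P'Q).
rewrite card_eq_sym; apply: inj_card_eq => P P' /set_mem AP /set_mem AP' ff.
by apply: (inj P P' (f P)) => //; rewrite ff; apply: rf.
Qed.

Section ReductionOfPoints.
Variables (L : fieldType) (w : valuation L).
Local Notation O := (valring w).
Implicit Types (P : P1 L) (Q : P1 (residue w)) (x y t : O) (z : residue w).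

Lemma v_unit_pair x y : v_unit x || v_unit y ->
  ((val x != 0) || (val y != 0)) /\ ((red x != 0) || (red y != 0)).
Proof.
rewrite !red_neq0 /v_unit => xy; split=> //.
by case/orP: xy => /andP[-> _]; rewrite ?orbT.
Qed.

Lemma reduces_to_fun P Q Q' : reduces_to w P Q -> reduces_to w P Q' -> Q = Q'.
Proof.
move=> [x [y [xy -> ->]]] [x' [y' [xy' e ->]]].
have [vxy rxy] := v_unit_pair xy; have [vxy' rxy'] := v_unit_pair xy'.
apply/(pt_eqP rxy rxy'); rewrite -!rmorphM; congr (red _); apply: val_inj.
by rewrite !rmorphM /=; apply/(pt_eqP vxy vxy').
Qed.

Lemma reduces_chart_pt i t : reduces_to w (chart_pt i (val t)) (chart_pt i (red t)).
Proof.
exists (if 0 == i then t else 1), (if 1 == i then t else 1).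
have u1 : v_unit (1 : O) by rewrite -red_neq0 rmorph1 oner_neq0.
split; first by case: i => [[|[|//]] ?] /=; rewrite u1 ?orbT.
- by rewrite /chart_pt !(fun_if val).
- by rewrite /chart_pt !(fun_if (@red _ _)) rmorph1.
Qed.

Lemma integral_chart_pt P : exists i t, P = chart_pt i (val t).
Proof.
have [[x ->]|->] := chart_ptP P; last by exists 1, 0; rewrite rmorph0.
have [] := orP (valring_total w x) => /valring_lift[t tE].
  by exists 0, t; rewrite tE.
have [x0|x0] := eqVneq x 0; first by exists 0, 0; rewrite x0 rmorph0.
exists 1, t; rewrite tE /chart_pt /= -(pt_scale 1 x^-1 x0).
by rewrite mulr1 divff.
Qed.

Lemma reduces_to_total P : exists Q, reduces_to w P Q.
Proof.
have [i [t ->]] := integral_chart_pt P; exists (chart_pt i (red t)).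
exact: reduces_chart_pt.
Qed.

Lemma reduces_to_chart_pt P i z : reduces_to w P (chart_pt i z) ->
  exists2 t, red t = z & P = chart_pt i (val t).
Proof.
move=> [x [y [xy -> /esym zE]]]; have [vxy rxy] := v_unit_pair xy.
have /(pt_eqP rxy (chart_pt_neq0 i z)) {zE} := zE.
case/orP: (ord2_case 0 i) => /eqP->; rewrite /chart_pt /=.
  rewrite mulr1 => xE; have y0 : red y != 0.
    by apply: contraTneq rxy => y0; rewrite xE y0 mulr0 eqxx.
  have [t tE] := valring_div x y0; exists t.
    by apply: (mulIf y0); rewrite -xE tE rmorphM.
  have vy0 : val y != 0 by move: y0; rewrite red_neq0 => /andP[].
  by rewrite -(pt_scale (val t) 1 vy0) mulr1 tE rmorphM /= mulrC.
rewrite mul1r => yE; have x0 : red x != 0.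
  by apply: contraTneq rxy => x0; rewrite -yE x0 mul0r eqxx.
have [t tE] := valring_div y x0; exists t.
  by apply: (mulIf x0); rewrite mulrC in yE; rewrite yE tE rmorphM.
have vx0 : val x != 0 by move: x0; rewrite red_neq0 => /andP[].
by rewrite -(pt_scale 1 (val t) vx0) mulr1 tE rmorphM /= mulrC.
Qed.

Lemma card_eq_reduction (E : set (P1 L)) : finite_set E ->
  E #= reduction_set w E <->
  (forall P P' Q, E P -> E P' -> reduces_to w P Q -> reduces_to w P' Q -> P = P').
Proof.
exact: card_eq_functional_image reduces_to_total reduces_to_fun.
Qed.

End ReductionOfPoints.

(** * Extension of valuations and reduced forms *)

Section ValuationExtension.
Variables (K L : fieldType) (iota : {rmorphism K -> L}).
Variables (v : valuation K) (w : valuation L).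
Hypothesis vw : extends_valuation iota v w.

Fact valring_map_subproof (x : valring v) : iota (val x) \in val_integral w.
Proof.
have := valP x; rewrite !unfold_in fmorph_eq0; case: eqVneq => //= x0.
by rewrite vw.
Qed.

Definition valring_map (x : valring v) : valring w := ValRing (valring_map_subproof x).

Lemma val_valring_map x : val (valring_map x) = iota (val x).
Proof. by []. Qed.

Fact valring_map_zmod_morphism : zmod_morphism valring_map.
Proof.
by move=> x y; apply: val_inj; rewrite rmorphB !val_valring_map !rmorphB.
Qed.
Fact valring_map_monoid_morphism : monoid_morphism valring_map.
Proof.
split=> [|x y]; apply: val_inj; first by rewrite val_valring_map !rmorph1.
by rewrite rmorphM !val_valring_map !rmorphM.
Qed.
HB.instance Definition _ := GRing.isZmodMorphism.Build (valring v) (valring w)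
  valring_map valring_map_zmod_morphism.
HB.instance Definition _ := GRing.isMonoidMorphism.Build (valring v) (valring w)
  valring_map valring_map_monoid_morphism.

Lemma red_valring_map_eq0 x : red x = 0 -> red (valring_map x) = 0.
Proof.
move/eqP; rewrite red_eq0 !unfold_in => x0; apply/eqP; rewrite red_eq0 unfold_in.
by rewrite val_valring_map fmorph_eq0; case: eqVneq x0 => //= x0; rewrite vw.
Qed.

Definition residue_map (y : residue v) : residue w :=
  red (valring_map (repr y)).

Lemma residue_map_red x : residue_map (red x) = red (valring_map x).
Proof.
have e : red (repr (red x)) = red x by rewrite {1}/red reprK.
apply/eqP; rewrite -subr_eq0 -!rmorphB; apply/eqP/red_valring_map_eq0.
by rewrite rmorphB /= e subrr.
Qed.

Fact residue_map_zmod_morphism : zmod_morphism residue_map.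
Proof.
move=> a b; have [x <-] := red_surj a; have [y <-] := red_surj b.
by rewrite -rmorphB !residue_map_red !rmorphB.
Qed.
Fact residue_map_monoid_morphism : monoid_morphism residue_map.
Proof.
split=> [|a b]; first by rewrite -[1](rmorph1 (@red K v)) residue_map_red !rmorph1.
have [x <-] := red_surj a; have [y <-] := red_surj b.
by rewrite -rmorphM !residue_map_red !rmorphM.
Qed.
HB.instance Definition _ := GRing.isZmodMorphism.Build (residue v) (residue w)
  residue_map residue_map_zmod_morphism.
HB.instance Definition _ := GRing.isMonoidMorphism.Build (residue v) (residue w)
  residue_map residue_map_monoid_morphism.

End ValuationExtension.

Section ReducedForms.
Variables (K : fieldType) (v : valuation K) (Phi : formpair K).
Local Notation O := (valring v).
Local Notation rd := (@red K v).
Implicit Types F G : {mpoly O[2]}.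

Lemma v_reduced_homog F G : num Phi \is (deg Phi).-homog ->
  den Phi \is (deg Phi).-homog -> v_reduced_form Phi F G ->
  F \is (deg Phi).-homog /\ G \is (deg Phi).-homog.
Proof.
move=> nd dd [[c c0 [FE GE]] _].
have aux (E : {mpoly O[2]}) C : C \is (deg Phi).-homog -> map_mpoly val E = c *: C ->
    E \is (deg Phi).-homog.
  move=> Cd EE; have /dhomogP Ed : map_mpoly val E \is (deg Phi).-homog.
    by rewrite EE dhomogZ.
  apply/dhomogP => m; rewrite mcoeff_msupp => Em; apply: Ed.
  by rewrite mcoeff_msupp mcoeff_map_mpoly /= val_eq0.
by split; [apply: aux FE | apply: aux GE].
Qed.

Lemma v_reduced_neq0 F G : v_reduced_form Phi F G ->
  (map_mpoly rd F != 0) || (map_mpoly rd G != 0).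
Proof.
move=> [_ [m]]; rewrite -!red_neq0 -!(mcoeff_map_mpoly rd) => /orP[] E0; apply/orP.
  by left; apply: contraNneq E0 => ->; rewrite mcoeff0.
by right; apply: contraNneq E0 => ->; rewrite mcoeff0.
Qed.

(** The ratio of the two scaling factors is integral, as it can be computed on a
    coefficient that is a unit in the first pair. *)
Lemma v_reduced_scale F G F' G' : v_reduced_form Phi F G -> v_reduced_form Phi F' G' ->
  exists u : O, F' = u *: F /\ G' = u *: G.
Proof.
move=> [[c c0 [FE GE]] [m Fm]] [[c' c'0 [FE' GE']] _].
have sc (E E' : {mpoly O[2]}) C : map_mpoly val E = c *: C ->
    map_mpoly val E' = c' *: C -> forall n, val E'@_n = c' / c * val E@_n.
  move=> EE EE' n; rewrite -!(mcoeff_map_mpoly val) EE EE' !mcoeffZ mulrA.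
  by rewrite divfK.
have [u uE] : exists u : O, val u = c' / c.
  have aux (E E' : {mpoly O[2]}) C : map_mpoly val E = c *: C ->
      map_mpoly val E' = c' *: C -> v_unit E@_m -> exists u : O, val u = c' / c.
    move=> EE EE' Em; have [|u E'u] := @valring_div _ _ E'@_m E@_m.
      by rewrite red_neq0.
    exists u; have Em0 : val E@_m != 0 by case/andP: Em.
    by apply: (mulIf Em0); rewrite -(sc _ _ _ EE EE') E'u rmorphM.
  by case/orP: Fm; [apply: aux FE FE' | apply: aux GE GE'].
exists u; split; apply/mpolyP => n; apply: val_inj; rewrite mcoeffZ rmorphM /= uE.
  exact: sc FE FE' n.
exact: sc GE GE' n.
Qed.

End ReducedForms.

(** * Critically good reduction *)

Section CriticalReduction.
Variables (L : closedFieldType) (w : valuation L).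
Hypothesis L_char0 : [pchar L] =i pred0.
Local Notation rd := (@red L w).
Variable Psi : formpair L.
Hypotheses (num_homog : num Psi \is (deg Psi).-homog).
Hypotheses (den_homog : den Psi \is (deg Psi).-homog).
Hypotheses (Psi_deg : (1 < deg Psi)%N).
Hypothesis Psi_coprime : forall i, coprimep (chart i (num Psi)) (chart i (den Psi)).
Variables (f g : 'I_2 -> {poly valring w}) (c : L).
Hypothesis c_neq0 : c != 0.
Hypothesis fE : forall i, map_poly val (f i) = c *: chart i (num Psi).
Hypothesis gE : forall i, map_poly val (g i) = c *: chart i (den Psi).
Hypothesis W_neq0 : forall i, map_poly rd (wronskian (f i) (g i)) != 0.
Implicit Types (i : 'I_2) (s t : valring w) (z : residue w).

Lemma map_val_wronskian i : map_poly val (wronskian (f i) (g i)) =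
  c ^+ 2 *: wronskian (chart i (num Psi)) (chart i (den Psi)).
Proof. by rewrite map_wronskian fE gE wronskianZ. Qed.

Lemma ramified_root i t : ramification_points Psi (chart_pt i (val t)) <->
  root (wronskian (f i) (g i)) t.
Proof.
rewrite /ramification_points /= ramified_chart //.
by rewrite -root_map_val map_val_wronskian rootZ ?expf_neq0.
Qed.

Lemma integral_coord_neq0 i t : (val (f i).[t] != 0) || (val (g i).[t] != 0).
Proof.
rewrite -!horner_map fE gE !hornerZ !mulf_eq0 (negPf c_neq0) /=.
have := coprimep_root (x := val t) (Psi_coprime i).
by rewrite /root; case: eqVneq => //= _; apply.
Qed.

Lemma eval_pt_integral i t :
  eval_pt Psi (chart_pt i (val t)) = pt (val (f i).[t]) (val (g i).[t]).
Proof.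
rewrite (eval_chart_pt num_homog den_homog) -(pt_scale _ _ c_neq0).
by rewrite -!hornerZ -fE -gE !horner_map.
Qed.

Lemma finite_ramification : finite_set (ramification_points Psi).
Proof.
have W0 : wronskian (chart 0 (num Psi)) (chart 0 (den Psi)) != 0.
  apply: contraNneq (map_val_neq0 (W_neq0 0)) => W0.
  by rewrite map_val_wronskian W0 scaler0.
have [r rE] := closed_field_poly_normal
  (wronskian (chart 0 (num Psi)) (chart 0 (den Psi))).
apply: (@sub_finite_set _ _ ([set chart_pt 1 0] `|`
    (@chart_pt L 0 @` [set` r]))%classic); last first.
  by rewrite finite_setU; split; [exact: finite_set1 | exact: finite_image].
move=> P Pram; have [[t Pt]|->] := chart_ptP P; [right|by left].
exists t => //=; move: Pram; rewrite Pt /ramification_points /= ramified_chart //.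
by rewrite rE rootZ ?lead_coef_eq0 // root_prod_XsubC.
Qed.

Lemma ramification_injP :
  ramification_points Psi #= reduction_set w (ramification_points Psi) <->
  forall i s t, red s = red t -> root (wronskian (f i) (g i)) s ->
    root (wronskian (f i) (g i)) t -> s = t.
Proof.
rewrite (card_eq_reduction w finite_ramification).
split=> [inj i s t st Ws Wt|inj P P' Q].
  apply: val_inj; apply: (@chart_pt_inj _ i).
  apply: (inj _ _ (chart_pt i (red s))); [exact/ramified_root|exact/ramified_root|..].
    exact: reduces_chart_pt.
  by rewrite st; apply: reduces_chart_pt.
have [i [t ->]] := integral_chart_pt w P => Wt Pram' tQ.
rewrite (reduces_to_fun tQ (reduces_chart_pt i t)) => /reduces_to_chart_pt[s st sP].
move: Pram'; rewrite sP => Ws; congr (chart_pt i (val _)).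
by apply: (inj i) => //; apply/ramified_root.
Qed.

Lemma critical_no_common_root i z :
  ramification_points Psi #= reduction_set w (ramification_points Psi) ->
  ~~ (root (map_poly rd (f i)) z && root (map_poly rd (g i)) z).
Proof.
move/ramification_injP => inj.
apply: (single_ramification_no_common_root L_char0 (W_neq0 i)).
  by move=> t _; have := integral_coord_neq0 i t; rewrite !val_eq0.
by move=> s t sz tz; apply: inj; rewrite sz tz.
Qed.

(** As f_v and g_v have no common zero, the images of points in one disc all have
    the reduction with coordinates f_v (z) and g_v (z). *)
Lemma no_common_root_critical :
  (forall i z, ~~ (root (map_poly rd (f i)) z && root (map_poly rd (g i)) z)) ->
  branch_points Psi #= reduction_set w (branch_points Psi) ->
  ramification_points Psi #= reduction_set w (ramification_points Psi).
Proof.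
move=> nc; rewrite (card_eq_reduction w (finite_image _ finite_ramification)).
move=> inj; apply/ramification_injP => i s0 t0 st0.
apply: (single_value_single_ramification L_char0 (W_neq0 i) (nc i (red t0))
  _ st0 erefl).
move=> s t sz tz Ws Wt.
have red_to u : red u = red t0 ->
    reduces_to w (eval_pt Psi (chart_pt i (val u)))
      (pt (map_poly rd (f i)).[red t0] (map_poly rd (g i)).[red t0]).
  move=> uz; exists (f i).[u], (g i).[u]; rewrite -uz !horner_map; split=> //.
    by have := nc i (red u); rewrite negb_and /root !horner_map -!red_neq0.
  exact: eval_pt_integral.
apply: val_inj; rewrite !rmorphM.
apply/(pt_eqP (integral_coord_neq0 i s) (integral_coord_neq0 i t)).
rewrite -!eval_pt_integral; apply: inj (red_to s sz) (red_to t tz).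
  by exists (chart_pt i (val s)) => //; apply/ramified_root.
by exists (chart_pt i (val t)) => //; apply/ramified_root.
Qed.

End CriticalReduction.

Section Descent.
Variables (K : fieldType) (L : closedFieldType) (iota : {rmorphism K -> L}).
Variables (v : valuation K) (w : valuation L) (vw : extends_valuation iota v w).
Implicit Types (i : 'I_2) (E : {mpoly (valring v)[2]}).

Lemma red_valring_map_chart i E :
  map_poly (@red L w) (map_poly (valring_map vw) (chart i E)) =
    map_poly (residue_map vw) (chart i (map_mpoly (@red K v) E)).
Proof.
rewrite -map_chart -[LHS]map_poly_comp -[RHS]map_poly_comp.
by apply: eq_map_poly => x /=; rewrite residue_map_red.
Qed.

Lemma val_valring_map_chart i E C (c : K) : map_mpoly val E = c *: C ->
  map_poly val (map_poly (valring_map vw) (chart i E)) =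
    iota c *: chart i (map_mpoly iota C).
Proof.
move=> EC; transitivity (map_poly iota (chart i (map_mpoly val E))).
  rewrite -map_chart -[LHS]map_poly_comp -[RHS]map_poly_comp.
  exact: eq_map_poly.
by rewrite EC chartZ map_polyZ /= map_chart.
Qed.

(** The residue field of w is algebraically closed, so that coprimality can be
    tested on its points. *)
Lemma residue_map_coprime (a b : {poly residue w}) (a' b' : {poly residue v}) :
  a = map_poly (residue_map vw) a' -> b = map_poly (residue_map vw) b' ->
  coprimep a' b' <-> (forall z, ~~ (root a z && root b z)).
Proof.
move=> aE bE; rewrite -(coprimep_map (residue_map vw)) -aE -bE {aE bE}.
split=> [cop z|nc].
  apply/negP => /andP[/(coprimep_root cop) /negbTE e /eqP bz].
  by rewrite bz eqxx in e.
apply/negPn/negP => ncop; suff [z] : exists z, root (gcdp a b) z.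
  by rewrite root_gcd; apply/negP.
move: ncop; rewrite /coprimep; case s: (size _) => [|[|n]] // _.
  by exists 0; move/eqP: s; rewrite size_poly_eq0 => /eqP->; rewrite root0.
by apply: residue_closed; rewrite s.
Qed.

Lemma residue_map_wronskian (a b : {poly valring w}) (a' b' : {poly residue v}) :
  map_poly (@red L w) a = map_poly (residue_map vw) a' ->
  map_poly (@red L w) b = map_poly (residue_map vw) b' ->
  wronskian a' b' != 0 -> map_poly (@red L w) (wronskian a b) != 0.
Proof.
move=> aE bE; rewrite (map_wronskian (@red L w)) aE bE.
by rewrite -(map_wronskian (residue_map vw)) map_poly_eq0.
Qed.

End Descent.

Lemma coprime_chart_scale (R : comNzRingType) (k : fieldType)
    (r : {rmorphism R -> k}) (u : R) (F G : {mpoly R[2]}) i :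
  coprimep (chart i (map_mpoly r (u *: F))) (chart i (map_mpoly r (u *: G))) ->
  coprimep (chart i (map_mpoly r F)) (chart i (map_mpoly r G)).
Proof.
rewrite !map_mpolyZ !chartZ; have [->|u0] := eqVneq (r u) 0; last first.
  by rewrite coprimepZl // coprimepZr.
by rewrite !scale0r coprime0p eqp01.
Qed.

(** Simple good reduction may be witnessed by a pair of reduced forms other than
    F and G; [coprime_chart_scale] goes from one pair to the other. *)
Lemma simple_good_reductionP (K : fieldType) (v : valuation K) (Phi : formpair K)
    (Phiv : formpair (residue v)) F G H : is_morphism Phi -> is_morphism Phiv ->
  v_reduced_form Phi F G ->
  map_mpoly (@red K v) F = H * num Phiv -> map_mpoly (@red K v) G = H * den Phiv ->
  simple_good_reduction v Phi <->
  forall i, coprimep (chart i (map_mpoly (@red K v) F))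
    (chart i (map_mpoly (@red K v) G)).
Proof.
move=> [nd dd _] Phiv_mor FG FE GE; have [Fd Gd] := v_reduced_homog nd dd FG.
have mFd := map_homog (@red K v) Fd; have mGd := map_homog (@red K v) Gd.
split=> [[Psi [Psi_mor [F' [G' [FG' [H' [FE' GE']]]]]] degE] i|cop].
  have [Fd' Gd'] := v_reduced_homog nd dd FG'.
  have mFd' := map_homog (@red K v) Fd'; have mGd' := map_homog (@red K v) Gd'.
  have := coprime_of_same_degree mFd' mGd' Psi_mor FE' GE' i (v_reduced_neq0 FG') degE.
  have [u [-> ->]] := v_reduced_scale FG FG'.
  exact: coprime_chart_scale.
exists Phiv; last exact: same_degree_of_coprime mFd mGd Phiv_mor FE GE cop.
by split=> //; exists F, G; split=> //; exists H.
Qed.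

Theorem theorem1p5 (K : fieldExtType rat) (iota : {rmorphism K -> algC})
    (v : valuation K) (hv : finite_place v)
    (w : valuation algC) (hw : extends_valuation iota v w)
    (Phi : formpair K) (hPhi : is_morphism Phi) (hdeg : (2 <= deg Phi)%N)
    (Phiv : formpair (residue v)) (hred : is_reduction v Phi Phiv)
    (p : nat) (hp : p \in [pchar residue v])
    (hsep : separable_morphism p Phiv) :
  critically_good_reduction iota w Phi <->
  simple_good_reduction v Phi /\ branch_card_preserved iota w Phi.
Proof.
have [Phiv_mor [F [G [FG [H [FE GE]]]]]] := hred.
have sgrP := simple_good_reductionP hPhi Phiv_mor FG FE GE.
have [nd dd _] := hPhi; have [Fd Gd] := v_reduced_homog nd dd FG.
have W0 i : wronskian (chart i (map_mpoly (@red K v) F))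
    (chart i (map_mpoly (@red K v) G)) != 0.
  apply: (wronskian_common_factor_neq0 (map_homog (@red K v) Fd)
    (map_homog (@red K v) Gd) FE GE (v_reduced_neq0 FG)).
  apply: (separable_wronskian_neq0 hp _ _ Phiv_mor hsep) => y.
  exact: residue_perfect hp.
pose F' i := map_poly (valring_map hw) (chart i F).
pose G' i := map_poly (valring_map hw) (chart i G).
have [[c c0 [FE' GE']] _] := FG.
have c'0 : iota c != 0 by rewrite fmorph_eq0.
have fE i := val_valring_map_chart hw i FE'.
have gE i := val_valring_map_chart hw i GE'.
have W'0 i := residue_map_wronskian (red_valring_map_chart hw i F)
  (red_valring_map_chart hw i G) (W0 i).
have copP i := residue_map_coprime (red_valring_map_chart hw i F)
  (red_valring_map_chart hw i G).
have copL i : coprimep (chart i (num (base_change iota Phi)))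
    (chart i (den (base_change iota Phi))).
  by rewrite /= -!map_chart coprimep_map coprime_chart.
have C0 := pchar_num algC.
have ndL := map_homog iota nd; have ddL := map_homog iota dd.
split=> [[Rcrit Bcrit]|[/sgrP cop Bcrit]]; split=> //.
  apply/sgrP => i; apply/copP => z.
  exact: (critical_no_common_root (Psi := base_change iota Phi) C0 ndL ddL hdeg
    copL (f := F') (g := G') c'0 fE gE W'0 i z Rcrit).
apply: (no_common_root_critical (Psi := base_change iota Phi) C0 ndL ddL hdeg
  copL (f := F') (g := G') c'0 fE gE W'0) Bcrit.
by move=> i; apply/copP.
Qed.
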